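(* Let $\dim Q=2$. Up to multiplication by a nonzero constant, the Poincar\'e-invariant Euler--Poisson equations of third order (in the sense specified in the context) on the domain $1+\mathsf v\cdot\mathsf v>0$ are exactly the equations $$-\frac{\ast\mathsf v''}{(1+\mathsf v\cdot\mathsf v)^{3/2}}+3\,\frac{\ast\mathsf v'}{(1+\mathsf v\cdot\mathsf v)^{5/2}}\,(\mathsf v\cdot\mathsf v')-\frac{\mu}{(1+\mathsf v\cdot\mathsf v)^{3/2}}\Big[(1+\mathsf v\cdot\mathsf v)\,\mathsf v'-(\mathsf v'\cdot\mathsf v)\,\mathsf v\Big]=0,$$ where $\mu\in\mathbb R$ is an arbitrary constant (a single scalar parameter). The left-hand side is a covector: its $i$-th component uses $(\ast\mathsf v'')_i$, $(\ast\mathsf v')_i$, $\mathsf v'_i=g_{ij}\mathsf v'^j$ and $\mathsf v_i=g_{ij}\mathsf v^j$.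
   Context: Coordinates and metric. $Q$ is two-dimensional with coordinates $\mathsf x^i$, $i=1,2$; space-time is $\mathbb R\times Q$ with coordinates $(t,\mathsf x^1,\mathsf x^2)$ and flat metric $\mathrm{diag}(1,-1,-1)$, i.e. $g_{00}=1$, $g_{ij}=-\delta_{ij}$. Write $\mathsf v=d\mathsf x/dt$, $\mathsf v'=d\mathsf v/dt$, $\mathsf v''=d\mathsf v'/dt$. For two vectors, $\mathsf a\cdot\mathsf b=g_{ij}\mathsf a^i\mathsf b^j$; indices are lowered with $g_{ij}$; $(\ast\mathsf a)_i=\epsilon_{ji}\mathsf a^j$ with $\epsilon_{12}=-\epsilon_{21}=1$, $\epsilon_{11}=\epsilon_{22}=0$. The domain is $\{(\mathsf v^1,\mathsf v^2): 1+\mathsf v\cdot\mathsf v>0\}$. Third-order Euler--Poisson equation. This is a system $\mathsf E_i=0$, $i=1,2$, whose left-hand sides $\mathsf E_i(t,\mathsf x,\mathsf v,\mathsf v',\mathsf v'')$ are the Euler--Poisson (higher-order Euler--Lagrange) expressions $\sum_{m\ge0}(-1)^m (d/dt)^m\,\partial L/\partial \mathsf x^i_{(m)}$ of some, locally defined, Lagrange function $L$ ($\mathsf x^i_{(m)}$ being the $m$-th derivative of $\mathsf x^i$), and which is genuinely of third order. Such a system always has the form $$\mathsf E_i=\mathsf A_{ij}\mathsf v''^j+\mathsf k_i,\qquad \mathsf k_i=\mathsf v'^l\frac{\partial \mathsf A_{ij}}{\partial \mathsf v^l}\mathsf v'^j+\mathsf B_{ij}\mathsf v'^j+\mathsf c_i,$$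 with a skew-symmetric matrix $\mathsf A_{ij}$, a matrix $\mathsf B_{ij}$ and a row $\mathsf c_i$ depending smoothly on $(t,\mathsf x,\mathsf v)$; genuinely of third order means that $\mathsf A$ is nowhere zero. Poincar\'e invariance. For such a system define the column of one-forms $\underline\epsilon=(\underline\epsilon_i)$, $\underline\epsilon_i=\mathsf A_{ij}\,d\mathsf v'^j+\mathsf k_i\,dt$, on $J^2(\mathbb R,Q)$ (coordinates $t,\mathsf x,\mathsf v,\mathsf v'$). The equation is called Poincar\'e-invariant if (1) $\mathsf A$ and $\mathsf k$ do not depend on $t$ and $\mathsf x$ (translations); (2) for every constant vector $\pi=(\pi^1,\pi^2)$ and every constant $\omega\in\mathbb R$, with $$\begin{aligned}X={}&-(\pi\cdot\mathsf x)\,\partial_t+t\,\pi^i\partial_{\mathsf x^i}+\big[\pi^i+(\pi\cdot\mathsf v)\,\mathsf v^i\big]\partial_{\mathsf v^i}+\big[2(\pi\cdot\mathsf v)\,\mathsf v'^i+(\pi\cdot\mathsf v')\,\mathsf v^i\big]\partial_{\mathsf v'^i}\\&+\omega\big(\mathsf x^1\partial_{\mathsf x^2}-\mathsf x^2\partial_{\mathsf x^1}+\mathsf v^1\partial_{\mathsf v^2}-\mathsf v^2\partial_{\mathsf v^1}+\mathsf v'^1\partial_{\mathsf v'^2}-\mathsf v'^2\partial_{\mathsf v'^1}\big)\end{aligned}$$ (the prolonged infinitesimal Lorentz transformation), there exist $2\times2$ matrices $\varPhi,\varXi,\varPi$ of functions of $\mathsf v$ and $\mathsf v'$ such that $$X(\underline\epsilon)=\varPhi\,\underline\epsilon+\varXi\,(d\mathsf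 x-\mathsf v\,dt)+\varPi\,(d\mathsf v-\mathsf v'\,dt),$$ where $X(\underline\epsilon)$ is the componentwise Lie derivative, and $d\mathsf x-\mathsf v\,dt$, $d\mathsf v-\mathsf v'\,dt$ are columns of one-forms. *)

(* Defs.v *)
(* MathComp + MathComp-Analysis, over an abstract R : realType. *)
From HB Require Import structures.
From mathcomp Require Import all_boot all_order all_algebra.
From mathcomp Require Import all_classical all_reals all_analysis.

Set Implicit Arguments.
Unset Strict Implicit.
Unset Printing Implicit Defensive.

Import Order.TTheory GRing.Theory Num.Theory.
Import numFieldNormedType.Exports.

Local Open Scope classical_set_scope.
Local Open Scope ring_scope.

(* Indices: 'I_2 = {0, 1} stands for the index set {1, 2}. *)
Section Metric.
Context {R : realType}.
Implicit Types a b v : 'rV[R]_2.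

Definition gmet (i j : 'I_2) : R := - (i == j)%:R.

(* epsilon_{12} = - epsilon_{21} = 1 *)
Definition eps (i j : 'I_2) : R := (i < j)%N%:R - (j < i)%N%:R.

Definition dot a b : R := \sum_i \sum_j gmet i j * a 0 i * b 0 j.
Definition lower a : 'rV[R]_2 := \row_i \sum_j gmet i j * a 0 j.
Definition star a : 'rV[R]_2 := \row_i \sum_j eps j i * a 0 j.

Definition lor v : R := 1 + dot v v.

(* components of the generator x^1 d/dx^2 - x^2 d/dx^1 *)
Definition rot a : 'rV[R]_2 :=
  \row_(i < 2) (if i == 0 then - a 0 1 else a 0 0).

End Metric.

Section Smooth.
Context {R : realType} {V W : normedModType R}.

(* For finite-dimensional V, x |-> f'(x) is C^k iff all the directional
   derivatives x |-> f'(x) u are. *)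
Fixpoint Ck_on (k : nat) (U : set V) (f : V -> W) : Prop :=
  match k with
  | 0 => forall x, U x -> {for x, continuous f}
  | k'.+1 => (forall x, U x -> differentiable f x) /\
             (forall u : V, Ck_on k' U ('D_u f))
  end.

(* meaningful for an open set U *)
Definition smooth_on (U : set V) (f : V -> W) := forall k, Ck_on k U f.

End Smooth.

(* The s-th jet space of R x Q: the first component is t, row m of the second
   one is the m-th derivative of x (rows 0, 1, 2, 3 are x, v, v', v''). *)
Definition jet (R : realType) (s : nat) : Type := (R * 'M[R]_(s.+1, 2))%type.

Section Jets.
Context {R : realType}.

(* only used for m <= s *)
Definition jrow (m : nat) s (p : jet R s) : 'rV[R]_2 := row (inord m) p.2.

(* the projection from s-jets to s'-jets; only used for s' <= s *)
Definition jtrunc s' s (p : jet R s) : jet R s' :=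
  (p.1, \matrix_(m < s'.+1) jrow m p).

(* the s-jet of the infinite jet (t, q), q m being the m-th derivative of x *)
Definition ijet s (t : R) (q : nat -> 'rV[R]_2) : jet R s :=
  (t, \matrix_(m < s.+1) q m).

(* the domain 1 + v.v > 0; only used for 1 <= s *)
Definition timelike s (p : jet R s) : Prop := 0 < lor (jrow 1 p).

(* d/dt = d/dt|_partial + sum_{m <= s, i} x_(m+1)^i d/dx_(m)^i: the derivative
   along the vector whose t-component is 1 and whose row m is row m+1 of p *)
Definition tder s (f : jet R s -> R) : jet R s.+1 -> R :=
  fun p => 'D_((1, row' ord0 p.2) : jet R s) f (jtrunc s p).

Fixpoint tdern m s (f : jet R s -> R) : jet R (m + s) -> R :=
  match m return jet R (m + s) -> R with
  | 0 => f
  | m'.+1 => tder (@tdern m' s f)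
  end.
Arguments tdern m {s} f.

(* partial derivative with respect to x_(m)^i *)
Definition pder s (m : 'I_s.+1) (i : 'I_2) (f : jet R s -> R) : jet R s -> R :=
  'D_((0, delta_mx m i) : jet R s) f.

Definition euler_lagrange r (L : jet R r -> R) (i : 'I_2)
    (t : R) (q : nat -> 'rV[R]_2) : R :=
  \sum_(m < r.+1) (-1) ^+ m * tdern m (pder m i L) (ijet (m + r) t q).

(* Lagrange functions are local and of arbitrary finite order. *)
Definition euler_poisson (E : jet R 3 -> 'rV[R]_2) : Prop :=
  forall t0 q0, 0 < lor (q0 1%N) ->
  exists r (U : set (jet R r)) (L : jet R r -> R),
    [/\ open U, U (ijet r t0 q0), smooth_on U L &
      forall t q i, U (ijet r t q) -> 0 < lor (q 1%N) ->
        E (ijet 3 t q) 0 i = euler_lagrange L i t q].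

Definition kcoef (A B : jet R 1 -> 'M[R]_2) (c : jet R 1 -> 'rV[R]_2)
    (p : jet R 2) : 'rV[R]_2 :=
  let z := jtrunc 1 p in
  let v' := jrow 2 p in
  \row_i (\sum_j \sum_l
            v' 0 l * pder (inord 1) l (fun y => A y i j) z * v' 0 j
          + \sum_j B z i j * v' 0 j + c z 0 i).

Definition third_order_form (E : jet R 3 -> 'rV[R]_2)
    (A B : jet R 1 -> 'M[R]_2) (c : jet R 1 -> 'rV[R]_2) : Prop :=
  [/\ forall i j, smooth_on (@timelike 1) (fun z => A z i j),
      forall i j, smooth_on (@timelike 1) (fun z => B z i j),
      forall i, smooth_on (@timelike 1) (fun z => c z 0 i),
      forall z, timelike z -> (A z)^T = - A z /\ A z != 0 &
      forall p, timelike p -> forall i,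
        E p 0 i = \sum_j A (jtrunc 1 p) i j * jrow 3 p 0 j
                  + kcoef A B c (jtrunc 2 p) 0 i].

End Jets.

Section Invariance.
Context {R : realType}.

(* A one-form on a vector space V sends a point and a (constant) vector to a
   scalar.  As [X, w] = - 'D_w X for a constant vector w, one has
   (L_X al)(w) = X (al w) + al ('D_w X). *)
Definition lie_derivative {V : normedModType R} (X : V -> V) (al : V -> V -> R)
    : V -> V -> R :=
  fun p w => 'D_(X p) (fun y => al y w) p + al p ('D_w X p).

(* A_ij dv'^j + k_i dt *)
Definition eform (A : jet R 1 -> 'M[R]_2) (k : jet R 2 -> 'rV[R]_2) (i : 'I_2)
    : jet R 2 -> jet R 2 -> R :=
  fun p w => \sum_j A (jtrunc 1 p) i j * jrow 2 w 0 j + k p 0 i * w.1.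

(* dx_(m)^i - x_(m+1)^i dt *)
Definition contact (m : nat) (i : 'I_2) : jet R 2 -> jet R 2 -> R :=
  fun p w => jrow m w 0 i - jrow m.+1 p 0 i * w.1.

Definition lorentz (pi : 'rV[R]_2) (om : R) (p : jet R 2) : jet R 2 :=
  let t := p.1 in
  let x := jrow 0 p in let v := jrow 1 p in let v' := jrow 2 p in
  (- dot pi x,
   \matrix_(m < 3) nth 0
     [:: t *: pi + om *: rot x;
         pi + dot pi v *: v + om *: rot v;
         (2 * dot pi v) *: v' + dot pi v' *: v + om *: rot v'] m).

Definition translation_invariant (A : jet R 1 -> 'M[R]_2)
    (k : jet R 2 -> 'rV[R]_2) : Prop :=
  (forall z z' : jet R 1, timelike z -> timelike z' ->
     jrow 1 z = jrow 1 z' -> A z = A z') /\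
  (forall p p' : jet R 2, timelike p -> timelike p' ->
     jrow 1 p = jrow 1 p' -> jrow 2 p = jrow 2 p' -> k p = k p').

Definition lorentz_invariant (A : jet R 1 -> 'M[R]_2)
    (k : jet R 2 -> 'rV[R]_2) : Prop :=
  forall (pi : 'rV[R]_2) (om : R),
  exists Phi Xi Pi : 'rV[R]_2 -> 'rV[R]_2 -> 'M[R]_2,
  forall p : jet R 2, timelike p -> forall (i : 'I_2) (w : jet R 2),
    let v := jrow 1 p in let v' := jrow 2 p in
    lie_derivative (lorentz pi om) (eform A k i) p w =
      \sum_j Phi v v' i j * eform A k j p w
      + \sum_j Xi v v' i j * contact 0 j p w
      + \sum_j Pi v v' i j * contact 1 j p w.

(* A and k are determined by E on the domain, hence the existential. *)
Definition poincare_invariant_third_order_EP (E : jet R 3 -> 'rV[R]_2) : Prop :=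
  euler_poisson E /\
  exists (A B : jet R 1 -> 'M[R]_2) (c : jet R 1 -> 'rV[R]_2),
    [/\ third_order_form E A B c,
        translation_invariant A (kcoef A B c) &
        lorentz_invariant A (kcoef A B c)].

Definition Emu (mu : R) (p : jet R 3) : 'rV[R]_2 :=
  let v := jrow 1 p in let v' := jrow 2 p in let v'' := jrow 3 p in
  - ((lor v `^ (3 / 2))^-1 *: star v'')
  + (3 * dot v v' / lor v `^ (5 / 2)) *: star v'
  - (mu / lor v `^ (3 / 2)) *: (lor v *: lower v' - dot v' v *: lower v).

End Invariance.

(* Main.v *)
Require Import Defs.
From HB Require Import structures.
From mathcomp Require Import all_boot all_order all_algebra.
From mathcomp Require Import all_classical all_reals all_analysis.
From mathcomp Require Import ring.

(** Throughout, |v| is the Euclidean norm, so that 1 + v.v = 1 - |v|^2, and a = A_12, so that A is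
    a times the standard skew-symmetric matrix.

    Invariance. On the vectors annihilated by the contact forms the invariance identity does not
    involve Xi and Pi; as A is invertible, it also determines Phi. What remains
    ([lorentz_components]) is an identity between k and its derivative along the Lorentz
    generator. For each velocity v there is a generator, a rotation corrected by a boost, that
    fixes v. For it the identity contains no derivative with respect to the velocity: it is a
    polynomial identity in the acceleration v', whose homogeneous parts are solved in
    [stabilizer_consequences]. Degree 0 gives c = 0. Degree 2 gives the gradient of log a, whence
    a = C (1 - |v|^2)^(-3/2) along each ray from the origin ([A_ray_constant]). Degree 1 says that
    the inverse of A times B commutes with the stabilizer of v in the Lorentz group. Such B form a
    plane, in which the symmetric ones are the multiples of (1 - |v|^2) delta_ij + v_i v_j. A boost
    along v, which moves the velocity along its ray, shows that for symmetric B the factor is again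
    a constant times (1 - |v|^2)^(-3/2) ([B_ray_constant]). The two constants are C and C mu.

    Variationality. The Euler-Poisson property enters through the symmetry of B ([helmholtz],
    [B_symmetric]). The Lagrangian is local and of unknown order r. The Euler-Lagrange operator
    linearised along a uniform motion is formally self-adjoint, because second derivatives of L
    commute ([derive_comm]) and variations commute with d/dt ([variation_tder]). Hence, for two
    variations phi and psi, the difference of psi.E'(phi) and phi.E'(psi) is the t-derivative of an
    expression bilinear in their derivatives ([linearized_sym]). Powers of t - a and t - b, of high
    exponent, in the two coordinates make this expression vanish at a and at b, and Rolle's theorem
    gives B_12 = B_21.

    Conversely, E_mu has the second-order Lagrangian
    mu sqrt (1 - |v|^2) - H v'_2, where H = v_1 / ((1 - (v_2)^2) sqrt (1 - |v|^2)) is a primitive of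
    (1 - |v|^2)^(-3/2) in v_1 ([euler_poisson_Emu]), and its invariance is a direct computation with
    explicit Phi, Xi and Pi ([Emu_lorentz_invariant]). *)

Set Implicit Arguments.
Unset Strict Implicit.
Unset Printing Implicit Defensive.

Import Order.TTheory GRing.Theory Num.Theory.
Import numFieldNormedType.Exports.

Local Open Scope classical_set_scope.
Local Open Scope ring_scope.

(** * Calculus of smooth functions *)

Section SmoothCalculus.
Context {R : realType}.
Implicit Types V : normedModType R.

Lemma near_differentiable V (W : normedModType R) (f g : V -> W) x :
  (\near x, f x = g x) -> differentiable f x -> differentiable g x.
Proof.
move=> fg df.
pose e : V -> W := g - f.
have eo : e \o shift x = cst (e x) + (0 : V -> W) +o_ 0 id.
  apply/eqaddoP => eps eps0.
  have [ex0 e0] : e x = 0 /\ \forall h \near (0 : V), e (h + x) = 0.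
    split; first by rewrite /e /= !fctE (nbhs_singleton fg) subrr.
    have : \forall y \near x, e y = 0.
      by near=> y; rewrite /e /= !fctE (near fg y)// subrr.
    by rewrite (near_shift 0) subr0.
  near=> h; rewrite !fctE /= ex0 (near e0 h)// addr0 subrr normr0.
  by rewrite mulr_ge0 // ltW.
have -> : g = f + e by rewrite /e addrC subrK.
apply: differentiableD => //.
have de : 'd e x = 0 :> (V -> W).
  apply/diff_unique; last exact: eo.
  exact: cst_continuous.
apply/diff_locallyP; rewrite de; split; last exact: eo.
exact: cst_continuous.
Unshelve. all: by end_near. Qed.

(** The two difference quotients are the same function of the increment. *)
Lemma derive_comp_affine V V' (l : {linear V -> V'}) (c : V') (f : V' -> R) x u :
  'D_u (fun y => f (l y + c)) x = 'D_(l u) f (l x + c).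
Proof.
rewrite /derive; set F := (fun h : R => _); set G := (fun h : R => _).
suff -> : F = G by [].
by apply/funext => h; rewrite /F /G /= linearP addrA.
Qed.

(** ['D_u f] is a function on the whole space of which only the values on U matter: the
    closure properties below compute it on U and conclude with this lemma. *)
Lemma Ck_ext k V (U : set V) (f g : V -> R) : open U ->
  (forall x, U x -> f x = g x) -> Ck_on k U f -> Ck_on k U g.
Proof.
move=> oU; have nU x : U x -> nbhs x U by move=> Ux; exact: open_nbhs_nbhs.
elim: k f g => [|k IH] f g fg /=.
  move=> cf x Ux.
  have nfg : {near x, f =1 g} by near=> y; apply: fg; near: y; exact: nU.
  rewrite /prop_for /continuous_at -fg //.
  apply: cvg_trans (cf x Ux); apply: near_eq_cvg; near=> y; rewrite (near nfg y) //.
case=> df Df; split=> [x Ux|u].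
  apply: near_differentiable (df x Ux).
  by near=> y; apply: fg; near: y; exact: nU.
apply: IH (Df u) => x Ux; apply: near_eq_derive.
by near=> y; apply: fg; near: y; exact: nU.
Unshelve. all: by end_near. Qed.

Lemma CkW k V (U : set V) (f : V -> R) : Ck_on k.+1 U f -> Ck_on k U f.
Proof.
elim: k f => [|k IH] f [df Df] /=.
  by move=> x Ux; exact/differentiable_continuous/df.
by split=> // u; apply: IH.
Qed.

Lemma Ck_cst k V (U : set V) (c : R) : Ck_on k U (fun=> c).
Proof.
elim: k c => [|k IH] c /=; first by move=> x _; exact: cst_continuous.
split=> // u; suff -> : 'D_u (fun=> c) = (fun=> 0) :> (V -> R) by exact: IH.
by apply/funext => x; rewrite derive_cst.
Qed.

Lemma CkD k V (U : set V) (f g : V -> R) : open U ->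
  Ck_on k U f -> Ck_on k U g -> Ck_on k U (fun x => f x + g x).
Proof.
move=> oU; elim: k f g => [|k IH] f g /=.
  by move=> cf cg x Ux; apply: continuousD; [exact: cf|exact: cg].
move=> [df Df] [dg Dg]; split=> [x Ux|u].
  exact: (differentiableD (df x Ux) (dg x Ux)).
apply: (@Ck_ext k _ U (fun x => 'D_u f x + 'D_u g x)) => //; last exact: IH.
move=> x Ux; rewrite -[in RHS]/(f + g) deriveD //.
  by apply: diff_derivable; exact: df.
by apply: diff_derivable; exact: dg.
Qed.

Lemma CkM k V (U : set V) (f g : V -> R) : open U ->
  Ck_on k U f -> Ck_on k U g -> Ck_on k U (fun x => f x * g x).
Proof.
move=> oU; elim: k f g => [|k IH] f g.
  by move=> /= cf cg x Ux; apply: continuousM; [exact: cf|exact: cg].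
move=> Cf Cg; have [df Df] := Cf; have [dg Dg] := Cg; split=> [x Ux|u].
  exact: (differentiableM (df x Ux) (dg x Ux)).
apply: (@Ck_ext k _ U (fun x => f x * 'D_u g x + g x * 'D_u f x)) => //.
  move=> x Ux; rewrite -[in RHS]/(f * g) deriveM //.
    by apply: diff_derivable; exact: df.
  by apply: diff_derivable; exact: dg.
have [Cf' Cg'] := (CkW Cf, CkW Cg).
by apply: CkD => //; apply: IH => //; [exact: Dg|exact: Df].
Qed.

Lemma Ck_comp_affine k V V' (U : set V') (l : {linear V -> V'}) (c : V')
    (f : V' -> R) : continuous l -> Ck_on k U f ->
  Ck_on k [set x | U (l x + c)] (fun x => f (l x + c)).
Proof.
move=> cl; elim: k f => [|k IH] f /=.
  move=> cf x Ux; apply: (@continuous_comp _ _ _ (fun x => l x + c) f); last exact: cf.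
  by apply: continuousD; [exact: cl|exact: cst_continuous].
move=> [df Df]; split=> [x Ux|u].
  have dl : differentiable (fun x => l x + c) x.
    have dl : differentiable l x by exact: linear_differentiable.
    exact: (differentiableD dl (differentiable_cst c x)).
  exact: (differentiable_comp dl (df _ Ux)).
have -> : 'D_u (fun x => f (l x + c)) = (fun x => 'D_(l u) f (l x + c)).
  by apply/funext => x; exact: derive_comp_affine.
exact: (IH _ (Df (l u))).
Qed.

(** The derivative of 1/f is a product of f' and powers of 1/f itself, so that the
    induction on k closes; the same happens for the square root. *)
Lemma CkV k V (U : set V) (f : V -> R) : open U -> (forall x, U x -> f x != 0) ->
  Ck_on k U f -> Ck_on k U (fun x => (f x)^-1).
Proof.
move=> oU f0; elim: k => [|k IH].
  by move=> cf x Ux; apply: continuousV; [exact: f0|exact: cf].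
move=> Cf; have [df Df] := Cf; split=> [x Ux|u].
  exact: (differentiableV (df x Ux) (f0 x Ux)).
apply: (@Ck_ext k _ U (fun x => - 1 * ('D_u f x * ((f x)^-1 * (f x)^-1)))) => //.
  move=> x Ux; rewrite (deriveV (f0 x Ux)); last exact: diff_derivable (df x Ux).
  by rewrite /GRing.scale /= expr2 invfM; ring.
apply: CkM => //; first exact: Ck_cst.
apply: CkM => //; first exact: Df.
have C1 : Ck_on k U (fun x => (f x)^-1) by apply: IH; apply: CkW.
exact: CkM.
Qed.

Lemma is_derive_sqrt V (f : V -> R) x u : 0 < f x -> differentiable f x ->
  is_derive x u (fun x => Num.sqrt (f x)) ('D_u f x * (2 * Num.sqrt (f x))^-1).
Proof.
move=> fx dfx; have dsq : differentiable (Num.sqrt : R -> R) (f x).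
  by apply/derivable1_diffP; have [] := is_derive1_sqrt fx.
have dc : differentiable (fun x => Num.sqrt (f x)) x.
  exact: (differentiable_comp dfx dsq).
split; first exact: diff_derivable.
rewrite deriveE // (_ : (fun x => _) = Num.sqrt \o f) // diff_comp //=.
rewrite -(deriveE u dfx) deriv1E; last exact/derivable1_diffP.
by rewrite derive1E derive_sqrt.
Qed.

Lemma Ck_sqrt k V (U : set V) (f : V -> R) : open U -> (forall x, U x -> 0 < f x) ->
  Ck_on k U f -> Ck_on k U (fun x => Num.sqrt (f x)).
Proof.
move=> oU f0; elim: k => [|k IH].
  move=> cf x Ux; apply: (@continuous_comp _ _ _ f Num.sqrt); first exact: cf.
  exact: sqrt_continuous.
move=> Cf; have [df Df] := Cf; split=> [x Ux|u].
  apply: (differentiable_comp (df x Ux)).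
  by apply/derivable1_diffP; have [] := is_derive1_sqrt (f0 x Ux).
apply: (@Ck_ext k _ U (fun x => 'D_u f x * (2 * Num.sqrt (f x))^-1)) => //.
  by move=> x Ux; have [_ ->] := is_derive_sqrt u (f0 x Ux) (df x Ux).
apply: CkM => //; first exact: Df.
apply: CkV => //.
  by move=> x Ux; rewrite mulf_neq0 ?pnatr_eq0 // gt_eqF // sqrtr_gt0 f0.
apply: CkM => //; first exact: Ck_cst.
by apply: IH; exact: CkW.
Qed.

Lemma smooth_differentiable V (U : set V) (f : V -> R) x :
  smooth_on U f -> U x -> differentiable f x.
Proof. by move=> /(_ 1%N) [df _]; exact: df. Qed.

Lemma smooth_derive V (U : set V) (f : V -> R) u :
  smooth_on U f -> smooth_on U ('D_u f).
Proof. by move=> sf k; have [_] := sf k.+1; apply. Qed.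

Lemma smooth_continuous V (U : set V) (f : V -> R) x :
  smooth_on U f -> U x -> {for x, continuous f}.
Proof. by move=> /(_ 0%N) cf /cf. Qed.

Lemma is_derive_line V (f : V -> R) (x u : V) (s : R) :
  derivable f (s *: u + x) u ->
  is_derive s 1 (fun r => f (r *: u + x)) ('D_u f (s *: u + x)).
Proof.
rewrite /derivable => df.
have E : (fun h : R => h^-1 *: (((fun r => f (r *: u + x)) \o shift s) (h *: 1)
            - f (s *: u + x))) =
         (fun h => h^-1 *: ((f \o shift (s *: u + x)) (h *: u) - f (s *: u + x))).
  by apply/funext => h /=; rewrite [h%:A]mulr1 scalerDl addrA.
by split; rewrite /derivable /derive E.
Qed.

Lemma mean_value_line V (f : V -> R) (x u : V) (h : R) : 0 < h ->
  (forall s, 0 <= s <= h -> differentiable f (s *: u + x)) ->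
  exists2 s, 0 <= s <= h & f (h *: u + x) - f x = 'D_u f (s *: u + x) * h.
Proof.
move=> h0 df; pose g r := f (r *: u + x).
have dg s : 0 <= s <= h -> is_derive s 1 g ('D_u f (s *: u + x)).
  by move=> sh; apply: is_derive_line; exact: diff_derivable (df s sh).
have [||s sI] := @MVT _ g (fun s => 'D_u f (s *: u + x)) 0 h h0.
- by move=> s /[!in_itv]/= /andP[s0 sh]; apply: dg; rewrite !ltW.
- apply: derivable_within_continuous => s /[!in_itv]/= sh.
  by have [] := dg s sh.
rewrite subr0 /g scale0r add0r => ->; exists s => //.
by move: sI; rewrite in_itv /= => /andP[s0 sh]; rewrite !ltW.
Qed.

(** The mean value theorem is applied along u, then along v. *)
Lemma second_difference V (f : V -> R) (x u v : V) (h : R) : 0 < h ->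
  (forall s r, 0 <= s <= h -> 0 <= r <= h ->
    differentiable f (s *: u + (r *: v + x)) /\
    differentiable ('D_u f) (s *: u + (r *: v + x))) ->
  exists s r, [/\ 0 <= s <= h, 0 <= r <= h &
    f (h *: u + (h *: v + x)) - f (h *: u + x) - (f (h *: v + x) - f x) =
    'D_v ('D_u f) (s *: u + (r *: v + x)) * h * h].
Proof.
move=> h0 df; pose g y := f (y + h *: v) - f y.
have h0h : 0 <= h <= h by rewrite lexx ltW.
have z0h : 0 <= (0 : R) <= h by rewrite lexx ltW.
have dfv s : 0 <= s <= h -> differentiable (fun y => f (y + h *: v)) (s *: u + x).
  move=> sh; apply: differentiable_comp => //=.
  by rewrite -addrA (addrC x); exact: (df s h sh h0h).1.
have df0 s : 0 <= s <= h -> differentiable f (s *: u + x).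
  by move=> sh; have := (df s 0 sh z0h).1; rewrite scale0r add0r.
have [s sh|s sh E1] := @mean_value_line _ g x u h h0.
  exact: (differentiableB (dfv s sh) (df0 s sh)).
have [r rh|r rh E2] := @mean_value_line _ ('D_u f) (s *: u + x) v h h0.
  by rewrite addrCA; exact: (df s r sh rh).2.
exists s, r; split => //.
have -> : f (h *: u + (h *: v + x)) - f (h *: u + x) - (f (h *: v + x) - f x) =
          g (h *: u + x) - g x.
  by rewrite /g -(addrA (h *: u)) (addrC x).
rewrite {}E1; congr (_ * _).
have D1 : is_derive (s *: u + x) u (fun y => f (y + h *: v))
                    ('D_u f (h *: v + (s *: u + x))).
  apply: DeriveDef; first exact: diff_derivable (dfv s sh).
  by rewrite (addrC (h *: v)); exact: (derive_comp_affine idfun).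
have D2 : is_derive (s *: u + x) u f ('D_u f (s *: u + x)).
  exact/derivableP/diff_derivable/df0.
transitivity ('D_u f (h *: v + (s *: u + x)) - 'D_u f (s *: u + x)).
  exact: (@derive_val _ _ _ _ _ _ _ (is_deriveB D1 D2)).
by rewrite (addrCA (s *: u)); exact: E2.
Qed.

Lemma nbhs_parallelogram V (x u v : V) (N : set V) : nbhs x N ->
  exists2 h : R, 0 < h & forall s r, 0 <= s <= h -> 0 <= r <= h ->
    N (s *: u + (r *: v + x)).
Proof.
move=> /nbhs_ballP [e /= e0 eN].
have d0 : 0 < `|u| + `|v| + 1 by rewrite ltr_wpDl // addr_ge0.
exists (e / (`|u| + `|v| + 1)); first by rewrite divr_gt0.
move=> s r /andP[s0 sh] /andP[r0 rh]; apply: eN.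
rewrite -ball_normE /= addrA opprD addrCA subrr addr0 normrN.
apply: (le_lt_trans (ler_normD _ _)); rewrite !normrZ !ger0_norm //.
apply: (@le_lt_trans _ _ (e / (`|u| + `|v| + 1) * (`|u| + `|v|))).
  by rewrite mulrDr lerD // ler_wpM2r.
by rewrite -mulrA gtr_pMr // mulrC ltr_pdivrMr // mul1r ltrDl.
Qed.

(** The two mixed derivatives of [derive_comm] agree at points that differ, but both points
    lie in an arbitrarily small parallelogram at x. *)
Lemma eq_continuous_parallelogram V (U : set V) (F G : V -> R) (x u v : V) :
  open U -> U x -> {for x, continuous F} -> {for x, continuous G} ->
  (forall h, 0 < h -> (forall s r, 0 <= s <= h -> 0 <= r <= h ->
      U (s *: u + (r *: v + x))) -> exists s r s' r',
    [/\ 0 <= s <= h, 0 <= r <= h, 0 <= s' <= h, 0 <= r' <= h &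
      F (s *: u + (r *: v + x)) = G (s' *: u + (r' *: v + x))]) ->
  F x = G x.
Proof.
move=> oU Ux cF cG FG.
apply/eqP/negPn/negP => FGx.
have e0 : 0 < `|F x - G x| / 2 by rewrite divr_gt0 // normr_gt0 subr_eq0.
have : nbhs x (fun y => [/\ U y, `|F x - F y| < `|F x - G x| / 2 &
                            `|G x - G y| < `|F x - G x| / 2]).
  near=> y; split.
  - near: y; exact: open_nbhs_nbhs.
  - near: y; exact: (cvgrPdist_lt _ _).1 cF _ e0.
  - near: y; exact: (cvgrPdist_lt _ _).1 cG _ e0.
move=> /(nbhs_parallelogram u v) [h h0 hN].
have [|s [r [s' [r' [sh rh sh' rh' E]]]]] := FG h h0.
  by move=> s r sh rh; have [] := hN s r sh rh.
have [_ aF _] := hN s r sh rh; have [_ _ aG] := hN s' r' sh' rh'.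
have := ler_distD (F (s *: u + (r *: v + x))) (F x) (G x).
rewrite leNgt (splitr `|F x - G x|) ltrD //.
by rewrite E distrC.
Unshelve. all: by end_near. Qed.

(** Symmetry of second derivatives. For small h the second difference is h^2 times a value
    near x of either mixed derivative, according to the order in which the mean value theorem
    is applied; both mixed derivatives are continuous at x. *)
Lemma derive_comm V (U : set V) (f : V -> R) (x u v : V) : open U ->
  smooth_on U f -> U x -> 'D_v ('D_u f) x = 'D_u ('D_v f) x.
Proof.
move=> oU sf Ux.
have cF : {for x, continuous ('D_v ('D_u f))}.
  exact: smooth_continuous (smooth_derive v (smooth_derive u sf)) Ux.
have cG : {for x, continuous ('D_u ('D_v f))}.
  exact: smooth_continuous (smooth_derive u (smooth_derive v sf)) Ux.
have FG h : 0 < h -> (forall s r, 0 <= s <= h -> 0 <= r <= h ->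
    U (s *: u + (r *: v + x))) -> exists s r s' r',
    [/\ 0 <= s <= h, 0 <= r <= h, 0 <= s' <= h, 0 <= r' <= h &
      'D_v ('D_u f) (s *: u + (r *: v + x)) =
      'D_u ('D_v f) (s' *: u + (r' *: v + x))].
  move=> h0 hU.
  have [|s [r [sh rh E1]]] := @second_difference _ f x u v h h0.
    move=> s r sh rh; split; apply: smooth_differentiable (hU _ _ sh rh) => //.
    exact: smooth_derive.
  have [|r' [s' [rh' sh' E2]]] := @second_difference _ f x v u h h0.
    move=> s' r' sh' rh'; rewrite (addrCA (s' *: v)).
    split; apply: smooth_differentiable (hU _ _ rh' sh') => //.
    exact: smooth_derive.
  exists s, r, s', r'.
  split; [exact: sh|exact: rh|exact: sh'|exact: rh'|rewrite (addrCA (s' *: u))].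
  have hN0 : h != 0 by rewrite gt_eqF.
  apply: (mulIf hN0); apply: (mulIf hN0); apply: (etrans (esym E1)).
  apply: (etrans _ E2); rewrite (addrCA (h *: v)); ring.
exact: (eq_continuous_parallelogram oU Ux cF cG FG).
Qed.

Lemma Ck_linear k V (U : set V) (l : {linear V -> R}) : continuous l ->
  Ck_on k U l.
Proof.
move=> cl; case: k => [|k] /=; first by move=> x _; exact: cl.
split=> [x _|u]; first exact: linear_differentiable.
suff -> : 'D_u l = fun=> l u by exact: Ck_cst.
by apply/funext => x; rewrite deriveE; [rewrite diff_lin|exact: linear_differentiable].
Qed.

Lemma Ck_sum k V (U : set V) (I : finType) (F : I -> V -> R) : open U ->
  (forall i, Ck_on k U (F i)) -> Ck_on k U (fun x => \sum_i F i x).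
Proof.
move=> oU CF; suff H r : Ck_on k U (fun x => \sum_(i <- r) F i x) by exact: H.
elim: r => [|i r IH].
  have -> : (fun x => \sum_(i <- [::]) F i x) = (fun=> 0).
    by apply/funext => x; rewrite big_nil.
  exact: Ck_cst.
have -> : (fun x => \sum_(j <- i :: r) F j x) =
    (fun x => F i x + \sum_(j <- r) F j x).
  by apply/funext => x; rewrite big_cons.
by apply: CkD.
Qed.

Lemma smooth_ext V (U : set V) (f g : V -> R) : open U ->
  (forall x, U x -> f x = g x) -> smooth_on U f -> smooth_on U g.
Proof. by move=> oU fg sf k; exact: Ck_ext oU fg (sf k). Qed.

Lemma is_derive_fsum V (I : finType) (F : I -> V -> R) (dF : I -> R) x v :
  (forall i, is_derive x v (F i) (dF i)) ->
  is_derive x v (fun y => \sum_i F i y) (\sum_i dF i).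
Proof.
move=> hF; suff H r : is_derive x v (fun y => \sum_(i <- r) F i y) (\sum_(i <- r) dF i)
  by exact: H.
elim: r => [|i r IH].
  have -> : (fun x => \sum_(i <- [::]) F i x) = cst 0.
    by apply/funext => y; rewrite big_nil.
  by rewrite big_nil; exact: is_derive_cst.
have -> : (fun x => \sum_(j <- i :: r) F j x) = F i + (fun x => \sum_(j <- r) F j x).
  by apply/funext => y; rewrite big_cons.
rewrite big_cons; exact: is_deriveD.
Qed.

Lemma is_derive_mul V (f g : V -> R) (x v : V) (df dg : R) :
  is_derive x v f df -> is_derive x v g dg ->
  is_derive x v (fun y => f y * g y) (f x * dg + g x * df).
Proof. by move=> hf hg; exact: (is_deriveM hf hg). Qed.

Lemma is_derive_diff V (f : V -> R) (x v : V) : differentiable f x ->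
  is_derive x v f ('D_v f x).
Proof. by move=> df; exact/derivableP/diff_derivable. Qed.

Lemma near_open_preimage V (U : set V) (f : R -> V) t : open U -> U (f t) ->
  {for t, continuous f} -> \forall r \near t, U (f r).
Proof. by move=> oU Ut ct; apply: ct; exact: open_nbhs_nbhs. Qed.

Lemma line_continuous V (x u : V) : continuous (fun r : R => r *: u + x).
Proof.
by move=> r; apply: cvgD; [exact: scalel_continuous|exact: cvg_cst].
Qed.

Lemma is_derive_add V (f g : V -> R) (x v : V) (df dg : R) :
  is_derive x v f df -> is_derive x v g dg ->
  is_derive x v (fun y => f y + g y) (df + dg).
Proof. by move=> hf hg; exact: is_deriveD. Qed.

Lemma is_derive_inv V (f : V -> R) (x v : V) (df : R) :
  f x != 0 -> is_derive x v f df ->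
  is_derive x v (fun y => (f y)^-1) (- (f x) ^- 2 * df).
Proof.
move=> fx0 [dfx <-]; apply: DeriveDef; first exact: derivableV.
exact: deriveV.
Qed.

Lemma differentiable_fsum V (I : finType) (F : I -> V -> R) x :
  (forall i, differentiable (F i) x) -> differentiable (fun y => \sum_i F i y) x.
Proof.
move=> dF; suff H r : differentiable (fun y => \sum_(i <- r) F i y) x by exact: H.
elim: r => [|i r IH].
  have -> : (fun x => \sum_(i <- [::]) F i x) = cst 0.
    by apply/funext => y; rewrite big_nil.
  exact: differentiable_cst.
have -> : (fun x => \sum_(j <- i :: r) F j x) = F i + (fun x => \sum_(j <- r) F j x).
  by apply/funext => y; rewrite big_cons.
exact: differentiableD.
Qed.

(** Meant for the generators of the Lorentz group, which are quadratic in the jet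
    coordinates: the difference quotient is affine in the increment. *)
Lemma derive_quadratic V (W : normedModType R) (F : V -> W) (p w : V) (a b : W) :
  (forall h : R, F (h *: w + p) = F p + h *: a + h ^+ 2 *: b) -> 'D_w F p = a.
Proof.
move=> hF; apply: cvg_lim => //=.
have : (fun h : R => a + h *: b) @ 0^' --> a.
  rewrite -[X in _ --> X]addr0 -[X in _ --> _ + X](scale0r b).
  apply: cvgD; first exact: cvg_cst.
  by apply: cvgZr_tmp; apply: cvg_within.
apply: cvg_trans; apply: near_eq_cvg; near=> h.
rewrite hF -(addrA (F p)) (addrC (F p)) addrK scalerDr !scalerA.
have h0 : h != 0 by near: h; exact: nbhs_dnbhs_neq.
by rewrite mulVf // scale1r expr2 mulKf.
Unshelve. all: by end_near. Qed.

Lemma eq_derive0_01 (F : R -> R) : (forall h : R, 0 <= h <= 1 -> is_derive h (1 : R) F (0 : R)) ->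
  F 1 = F 0.
Proof.
move=> dF; have [||x xI] := @MVT_segment R F (fun=> 0) 0 1 ler01.
- by move=> x /[!in_itv]/= /andP[x0 x1]; apply: dF; rewrite !ltW.
- by apply: derivable_within_continuous => x /[!in_itv]/= /dF [].
by rewrite mul0r => /eqP; rewrite subr_eq0 => /eqP.
Qed.

Lemma is_derive_quad (c h : R) :
  is_derive h (1 : R) (fun r : R => 1 - r * r * c) (- (2 * h * c)).
Proof.
have hc (d : R) : is_derive h (1 : R) (fun=> d : R) (0 : R) by exact: is_derive_cst.
have hi : is_derive h (1 : R) (fun r : R => r) (1 : R) by exact: is_derive_id.
have := is_deriveB (hc 1) (is_derive_mul (is_derive_mul hi hi) (hc c)) => dd.
by apply: (is_derive_eq dd); ring.
Qed.

Lemma is_derive_pow32 (c h : R) : 0 < 1 - h * h * c ->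
  is_derive h (1 : R) (fun r : R => (1 - r * r * c) * Num.sqrt (1 - r * r * c))
    (- (3 * h * c * Num.sqrt (1 - h * h * c))).
Proof.
move=> g0; have dq := is_derive_quad c h.
have dg : differentiable (fun r : R => 1 - r * r * c) h.
  by apply/derivable1_diffP; case: dq.
have ds := @is_derive_sqrt _ (fun r : R => 1 - r * r * c) h (1 : R) g0 dg.
rewrite (@derive_val _ _ _ _ _ _ _ dq) in ds.
apply: (is_derive_eq (is_derive_mul dq ds)).
set s := Num.sqrt _; have s0 : s != 0 by rewrite gt_eqF // sqrtr_gt0.
have -> : 1 - h * h * c = s ^+ 2 by rewrite sqr_sqrtr // ltW.
by field.
Qed.

End SmoothCalculus.

(* Keeps unification from unfolding derivatives into limits. *)
Local Opaque derive.

(** * Coordinates on the jet spaces *)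

Local Notation rot := Defs.rot.

Section JetCoordinates.
Context {R : realType}.
Implicit Types (s m : nat) (t : R) (q : nat -> 'rV[R]_2).

Lemma sum2 (F : 'I_2 -> R) : \sum_i F i = F 0 + F 1.
Proof. by rewrite big_ord_recl big_ord1; congr (_ + F _); apply/val_inj. Qed.

Lemma ord2P (P : 'I_2 -> Prop) : P 0 -> P 1 -> forall i, P i.
Proof.
move=> h0 h1 [[|[|i]] hi] //; [move: h0|move: h1].
- by congr P; apply/val_inj.
- by congr P; apply/val_inj.
Qed.

(** Reduces an identity that follows from another one to a ring identity. *)
Lemma eq_from (a b c d : R) : a = b -> c - d = a - b -> c = d.
Proof. by move=> -> /eqP; rewrite subrr subr_eq0 => /eqP. Qed.

Definition row2 (x y : R) : 'rV[R]_2 := \row_i (if i == 0 then x else y).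

Lemma row2E x y : (row2 x y 0 0 = x) * (row2 x y 0 1 = y).
Proof. by rewrite !mxE. Qed.

Lemma dotE (a b : 'rV[R]_2) : dot a b = - (a 0 0 * b 0 0 + a 0 1 * b 0 1).
Proof. rewrite /dot !sum2 /gmet !eqxx /=; ring. Qed.

Lemma lorE (v : 'rV[R]_2) : lor v = 1 - (v 0 0 ^+ 2 + v 0 1 ^+ 2).
Proof. by rewrite /lor dotE !expr2. Qed.

Lemma rotE (a : 'rV[R]_2) : (rot a 0 0 = - a 0 1) * (rot a 0 1 = a 0 0).
Proof. by rewrite !mxE. Qed.

Lemma starE (a : 'rV[R]_2) : (star a 0 0 = - a 0 1) * (star a 0 1 = a 0 0).
Proof. by rewrite !mxE !sum2 /eps /=; split; ring. Qed.

Lemma lowerE (a : 'rV[R]_2) i : lower a 0 i = - a 0 i.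
Proof. by rewrite !mxE !sum2 /gmet; move: i; apply: ord2P => /=; ring. Qed.

Lemma jrow_ijet s t q m : (m <= s)%N -> jrow m (ijet s t q) = q m.
Proof. by move=> ms; apply/rowP => i; rewrite !mxE /= inordK. Qed.

Lemma jtrunc_ijet s' s t q : (s' <= s)%N -> jtrunc s' (ijet s t q) = ijet s' t q.
Proof.
move=> ss; congr (_, _); apply/matrixP => i j.
by rewrite !mxE inordK //= ltnS (leq_trans _ ss) // -ltnS.
Qed.

Lemma ijet_jrow s (p : jet R s) : p = ijet s p.1 (fun m => jrow m p).
Proof.
case: p => t M; congr (_, _); apply/matrixP => i j.
by rewrite !mxE inord_val.
Qed.

Lemma eq_ijet s t q q' : (forall m, (m <= s)%N -> q m = q' m) ->
  ijet s t q = ijet s t q'.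
Proof.
by move=> e; congr (_, _); apply/matrixP => i j; rewrite !mxE e // -ltnS.
Qed.

Lemma jrow_jtrunc m s' s (p : jet R s) : (m <= s')%N -> (s' <= s)%N ->
  jrow m (jtrunc s' p) = jrow m p.
Proof.
move=> ms ss; rewrite [p in LHS]ijet_jrow jtrunc_ijet // jrow_ijet //.
Qed.

Lemma jtrunc_jtrunc s'' s' s (p : jet R s) : (s'' <= s')%N -> (s' <= s)%N ->
  jtrunc s'' (jtrunc s' p) = jtrunc s'' p.
Proof.
move=> h1 h2; rewrite (ijet_jrow p) !jtrunc_ijet //; exact: leq_trans h1 h2.
Qed.

Lemma ijetD s t t' q q' :
  ijet s t q + ijet s t' q' = ijet s (t + t') (fun m => q m + q' m).
Proof. by congr (_, _); apply/matrixP => i j; rewrite !mxE. Qed.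

Lemma ijetZ s c t q : c *: ijet s t q = ijet s (c * t) (fun m => c *: q m).
Proof. by congr (_, _); apply/matrixP => i j; rewrite !mxE. Qed.

Lemma tder_ijet s (f : jet R s -> R) t q :
  tder f (ijet s.+1 t q) = 'D_(ijet s 1 (fun m => q m.+1)) f (ijet s t q).
Proof.
rewrite /tder (jtrunc_ijet t q (leqnSn s)).
have -> : ((1, row' ord0 (ijet s.+1 t q).2) : jet R s) = ijet s 1 (fun m => q m.+1).
  by congr (_, _); apply/matrixP => i j; rewrite !mxE.
by [].
Qed.

Lemma ijet_basis s t q : ijet s t q = t *: ijet s 1 (fun=> 0) +
  \sum_(k : 'I_s.+1 * 'I_2) q k.1 0 k.2 *: ((0, delta_mx k.1 k.2) : jet R s).
Proof.
rewrite ijetZ; have -> : \sum_(k : 'I_s.+1 * 'I_2) q k.1 0 k.2 *: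
    ((0, delta_mx k.1 k.2) : jet R s) = ijet s 0 q.
  rewrite [LHS]surjective_pairing; congr (_, _).
    by rewrite (raddf_sum fst) /= big1 // => k _; exact: mulr0.
  rewrite (raddf_sum snd) /=.
  rewrite -(pair_bigA _ (fun (i : 'I_s.+1) (j : 'I_2) => q i 0 j *: delta_mx i j)) /=.
  rewrite [RHS]matrix_sum_delta; apply: eq_bigr => i _; apply: eq_bigr => j _.
  by rewrite !mxE.
rewrite ijetD mulr1 addr0; apply: eq_ijet => m _; by rewrite scaler0 add0r.
Qed.

Lemma derive_ijet s (f : jet R s -> R) t q x : differentiable f x ->
  'D_(ijet s t q) f x = t * 'D_(ijet s 1 (fun=> 0)) f x +
    \sum_(k : 'I_s.+1 * 'I_2) q k.1 0 k.2 * pder k.1 k.2 f x.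
Proof.
move=> df; rewrite deriveE // ijet_basis linearD linearZ linear_sum /= -deriveE //.
congr (_ + _); apply: eq_bigr => k _.
by rewrite linearZ /= /pder deriveE.
Qed.

Definition jcoord s (k : 'I_s.+1 * 'I_2) (p : jet R s) : R := p.2 k.1 k.2.

Fact jcoord_is_linear s k : linear (@jcoord s k).
Proof. by move=> c p p'; rewrite /jcoord !mxE. Qed.
HB.instance Definition _ s k :=
  GRing.isLinear.Build R (jet R s) R _ (@jcoord s k) (@jcoord_is_linear s k).

Lemma jcoord_continuous s k : continuous (@jcoord s k).
Proof.
move=> p; apply: (@continuous_comp _ _ _ snd (fun M : 'M[R]_(s.+1, 2) => M k.1 k.2)).
  exact: cvg_snd.
exact: coord_continuous.
Qed.

Fact jtrunc_is_linear s' s : linear (@jtrunc R s' s).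
Proof. by move=> c p p'; congr (_, _); apply/matrixP => i j; rewrite !mxE. Qed.
HB.instance Definition _ s' s :=
  GRing.isLinear.Build R (jet R s) (jet R s') _ (@jtrunc R s' s)
    (@jtrunc_is_linear s' s).

Lemma jtrunc_continuous s' s : continuous (@jtrunc R s' s).
Proof.
apply/linear_bounded_continuous/linear_boundedP; near=> r => p.
apply: (@le_trans _ _ `|p|); last first.
  rewrite -[leLHS]mul1r ler_wpM2r //; near: r; exact: nbhs_pinfty_ge.
rewrite !prod_normE ge_max le_max lexx /= le_max; apply/orP; right.
rewrite /Num.norm /= !mx_normrE; apply/bigmax_leP; split.
  exact: bigmax_ge_id.
by move=> k _; rewrite !mxE; apply: (le_bigmax _ (fun k => `|p.2 k.1 k.2|) (_, _)).
Unshelve. all: by end_near. Qed.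

Lemma jrow_linear m s (h : R) (w p : jet R s) : jrow m (h *: w + p) = h *: jrow m w + jrow m p.
Proof. by apply/rowP => i; rewrite !mxE. Qed.

Lemma jrow_delta s m (o : 'I_s.+1) (i j : 'I_2) : (m <= s)%N ->
  jrow m ((0, delta_mx o i) : jet R s) 0 j = ((m == o) && (j == i))%:R.
Proof.
move=> ms; rewrite !mxE /=; congr (_ && _)%:R.
by rewrite -val_eqE /= inordK.
Qed.

Lemma is_derive_jtrunc s' s (f : jet R s' -> R) (p w : jet R s) :
  differentiable f (jtrunc s' p) ->
  is_derive p w (fun y => f (jtrunc s' y)) ('D_(jtrunc s' w) f (jtrunc s' p)).
Proof.
move=> df; apply: DeriveDef.
  apply: diff_derivable; apply: differentiable_comp => //.
  by apply: linear_differentiable; exact: jtrunc_continuous.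
have := @derive_comp_affine _ _ _ (@jtrunc R s' s) 0 f p w; rewrite addr0 => <-.
by congr ('D_w _ p); apply/funext => y; rewrite addr0.
Qed.

Lemma is_derive_jcoord s (k : 'I_s.+1 * 'I_2) (p w : jet R s) :
  is_derive p w (jcoord k) (jcoord k w).
Proof.
have dk : differentiable (jcoord k) p.
  by apply: linear_differentiable; exact: jcoord_continuous.
apply: DeriveDef; first exact: diff_derivable.
by rewrite deriveE // diff_lin //; exact: jcoord_continuous.
Qed.

Lemma is_derive_jrow s m l (p w : jet R s) :
  is_derive p w (fun y => jrow m y 0 l) (jrow m w 0 l).
Proof.
rewrite (_ : (fun y => _) = jcoord (inord m, l)).
  rewrite (_ : jrow m w 0 l = jcoord (inord m, l) w); first exact: is_derive_jcoord.
  by rewrite mxE.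
by apply/funext => y; rewrite mxE.
Qed.

Lemma differentiable_jrow s m l (p : jet R s) :
  differentiable (fun y : jet R s => jrow m y 0 l) p.
Proof.
rewrite (_ : (fun y => _) = jcoord (inord m, l)).
  by apply: linear_differentiable; exact: jcoord_continuous.
by apply/funext => y; rewrite mxE.
Qed.

Lemma differentiable_jtrunc s' s (f : jet R s' -> R) (p : jet R s) :
  differentiable f (jtrunc s' p) -> differentiable (fun y => f (jtrunc s' y)) p.
Proof.
move=> df; apply: differentiable_comp => //.
by apply: linear_differentiable; exact: jtrunc_continuous.
Qed.

End JetCoordinates.

(** * Total derivatives of smooth functions *)

Section TotalDerivative.
Context {R : realType}.

Lemma jtrunc_id s (p : jet R s) : jtrunc s p = p.
Proof. by rewrite [RHS]ijet_jrow {1}(ijet_jrow p) jtrunc_ijet. Qed.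

Lemma open_jtrunc s' s (U : set (jet R s')) : open U ->
  open [set p : jet R s | U (jtrunc s' p)].
Proof. by apply: open_comp => p _; exact: jtrunc_continuous. Qed.

Lemma smooth_jtrunc s' s (U : set (jet R s')) (f : jet R s' -> R) :
  smooth_on U f ->
  smooth_on [set p : jet R s | U (jtrunc s' p)] (fun p => f (jtrunc s' p)).
Proof.
move=> sf k; have := @Ck_comp_affine _ k _ _ U (@jtrunc R s' s) 0 f
  (@jtrunc_continuous R s' s) (sf k).
have -> : (fun x => f (jtrunc s' x + 0)) = (fun p => f (@jtrunc R s' s p)).
  by apply/funext => p; rewrite addr0.
have -> : [set x | U (@jtrunc R s' s x + 0)] = [set p | U (jtrunc s' p)].
  by apply/funext => p /=; rewrite addr0.
exact.
Qed.

Lemma smooth_jcoord s (U : set (jet R s)) k : smooth_on U (jcoord k).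
Proof. by move=> n; apply: Ck_linear; exact: jcoord_continuous. Qed.

Lemma smooth_jrow s (U : set (jet R s)) m i : smooth_on U (fun p => jrow m p 0 i).
Proof.
have -> : (fun p : jet R s => jrow m p 0 i) = jcoord (inord m, i).
  by apply/funext => z; rewrite mxE.
exact: smooth_jcoord.
Qed.

Definition next_coord s (k : 'I_s.+1 * 'I_2) : 'I_s.+2 * 'I_2 := (lift ord0 k.1, k.2).

Lemma jcoord_ijet s t q (k : 'I_s.+1 * 'I_2) :
  jcoord k (ijet s t q : jet R s) = q k.1 0 k.2.
Proof. by rewrite /jcoord mxE. Qed.

(** Written with coordinates and partial derivatives, [tder f] is visibly smooth where f is. *)
Lemma tderE s (f : jet R s -> R) p : differentiable f (jtrunc s p) ->
  tder f p = 'D_(ijet s 1 (fun=> 0)) f (jtrunc s p) +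
    \sum_(k : 'I_s.+1 * 'I_2) jcoord (next_coord k) p * pder k.1 k.2 f (jtrunc s p).
Proof.
move: (ijet_jrow p); move: p.1 (fun m => jrow m p) => t q ->.
rewrite jtrunc_ijet // => df; rewrite tder_ijet derive_ijet // mul1r.
congr (_ + _); apply: eq_bigr => k _; congr (_ * _).
by rewrite jcoord_ijet.
Qed.

Lemma smooth_tder s (U : set (jet R s)) (f : jet R s -> R) : open U ->
  smooth_on U f -> smooth_on [set p : jet R s.+1 | U (jtrunc s p)] (tder f).
Proof.
move=> oU sf; have oV := @open_jtrunc s s.+1 _ oU.
pose g (p : jet R s.+1) := 'D_(ijet s 1 (fun=> 0)) f (jtrunc s p) +
    \sum_(k : 'I_s.+1 * 'I_2) jcoord (next_coord k) p * pder k.1 k.2 f (jtrunc s p).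
apply: (@smooth_ext _ _ _ g) => //.
  by move=> p Up; rewrite tderE //; exact: smooth_differentiable sf Up.
move=> n; apply: CkD => //.
  exact: (smooth_jtrunc s.+1 (smooth_derive _ sf) n).
apply: Ck_sum => // k; apply: CkM => //; first exact: smooth_jcoord.
exact: (smooth_jtrunc s.+1 (smooth_derive _ sf) n).
Qed.

Lemma smooth_tdern r (U : set (jet R r)) (f : jet R r -> R) m : open U ->
  smooth_on U f ->
  smooth_on [set p : jet R (m + r) | U (jtrunc r p)] (@tdern R m r f).
Proof.
move=> oU sf; elim: m => [|m IH].
  have -> : [set p : jet R (0 + r) | U (jtrunc r p)] = U; last exact: sf.
  by apply/funext => p; exact: (congr1 U (jtrunc_id p)).
have := smooth_tder (@open_jtrunc r (m + r) U oU) IH.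
congr (smooth_on _ _); apply/funext => p /=.
by rewrite jtrunc_jtrunc // leq_addl.
Qed.

End TotalDerivative.

Section Timelike.
Context {R : realType}.

Definition jlor s (p : jet R s) : R := lor (jrow 1 p).

Lemma smooth_jlor s (U : set (jet R s)) : open U -> smooth_on U (@jlor s).
Proof.
move=> oU; pose c i (p : jet R s) := jcoord (inord 1, i) p.
have sc i : smooth_on U (c i) by exact: smooth_jcoord.
apply: (@smooth_ext _ _ _ (fun p => 1 + -1 * (c 0 p * c 0 p + c 1 p * c 1 p))) => //.
  move=> p _; rewrite /jlor lorE /c /jcoord /jrow !mxE /=; ring.
move=> k; apply: CkD => //; first exact: Ck_cst.
by apply: CkM => //; [exact: Ck_cst|apply: CkD => //; apply: CkM => //; exact: sc].
Qed.

Lemma open_timelike s : open [set p : jet R s | timelike p].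
Proof.
have -> : [set p : jet R s | timelike p] = @jlor s @^-1` [set x | 0 < x] by [].
apply: open_comp; last exact: open_gt.
move=> p _; exact: (smooth_continuous (smooth_jlor openT)).
Qed.

Lemma near_timelike s (z : jet R s) (f g : jet R s -> R) : timelike z ->
  (forall y, timelike y -> f y = g y) -> \forall y \near z, f y = g y.
Proof.
move=> tz fg; have : \forall y \near z, timelike y.
  by apply: open_nbhs_nbhs; split; [exact: open_timelike|].
by apply: filterS => y; exact: fg.
Qed.

End Timelike.

(** * A Helmholtz condition for Lagrangians of arbitrary order *)

Section Helmholtz.
Context {R : realType}.

(** The derivatives at time t of the uniform motion x = t v. *)
Definition ray (v : 'rV[R]_2) (t : R) : nat -> 'rV[R]_2 := nth 0 [:: t *: v; v].

Lemma ijet_ray s v t : ijet s t (ray v t) =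
  t *: ijet s 1 (nth 0 [:: v]) + ijet s 0 (nth 0 [:: 0; v]).
Proof.
rewrite ijetZ ijetD mulr1 addr0; apply: eq_ijet => -[|[|m]] _ /=.
- by rewrite addr0.
- by rewrite scaler0 add0r.
- by rewrite /ray /= !nth_nil scaler0 addr0.
Qed.

(** The derivative at s = 0 of f along the jets of t v + s phi, where [phi t m] stands for the
    m-th derivative at t of the variation phi of the motion. *)
Definition variation (v : 'rV[R]_2) s (f : jet R s -> R) (phi : R -> nat -> 'rV[R]_2)
    (t : R) : R :=
  'D_(ijet s 0 (phi t)) f (ijet s t (ray v t)).

Definition deriv_chain (phi : R -> nat -> 'rV[R]_2) :=
  forall (t : R) m i, is_derive t (1 : R) (fun r => phi r m 0 i) (phi t m.+1 0 i).

(** Variations commute with d/dt. The jet of a uniform motion moves along a straight line, so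
    both sides expand into the same partial derivatives of f of order at most two, up to the
    order of differentiation. *)
Lemma variation_tder v s (U : set (jet R s)) (f : jet R s -> R) phi t : open U ->
  smooth_on U f -> deriv_chain phi -> U (ijet s t (ray v t)) ->
  is_derive t 1 (variation v f phi) (variation v (tder f) phi t).
Proof.
move=> oU sf hphi Ut.
have df (g : jet R s -> R) p : smooth_on U g -> U p -> differentiable g p.
  exact: smooth_differentiable.
have sd u : smooth_on U ('D_u f) by exact: smooth_derive.
pose A r := \sum_(k : 'I_s.+1 * 'I_2)
  phi r k.1 0 k.2 * pder k.1 k.2 f (ijet s r (ray v r)).
pose e := ijet s 1 (nth 0 [:: v]).
have nA : \forall r \near t, A r = variation v f phi r.
  have : \forall r \near t, U (ijet s r (ray v r)).
    apply: near_open_preimage => //.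
    have -> : (fun r => ijet s r (ray v r)) =
      (fun r => r *: e + ijet s 0 (nth 0 [:: 0; v])).
      by apply/funext => r; exact: ijet_ray.
    exact: line_continuous.
  apply: filterS => r Ur; rewrite /variation derive_ijet ?mul0r ?add0r //.
  exact: df sf Ur.
apply: (near_eq_is_derive nA).
have dA : is_derive t 1 A (\sum_(k : 'I_s.+1 * 'I_2)
   (phi t k.1 0 k.2 * 'D_e (pder k.1 k.2 f) (ijet s t (ray v t)) +
    pder k.1 k.2 f (ijet s t (ray v t)) * phi t k.1.+1 0 k.2)).
  apply: is_derive_fsum => k; apply: is_derive_mul; first exact: hphi.
  have -> : (fun r => pder k.1 k.2 f (ijet s r (ray v r))) =
    (fun r => pder k.1 k.2 f (r *: e + ijet s 0 (nth 0 [:: 0; v]))).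
    by apply/funext => r; rewrite ijet_ray.
  rewrite ijet_ray; apply: is_derive_line; rewrite -ijet_ray.
  by apply: diff_derivable; apply: df => //; exact: sd.
apply: (is_derive_eq dA); rewrite /variation.
pose g (p : jet R s.+1) := 'D_(ijet s 1 (fun=> 0)) f (jtrunc s p) +
    \sum_(k : 'I_s.+1 * 'I_2) jcoord (next_coord k) p * pder k.1 k.2 f (jtrunc s p).
have ng : \forall p \near ijet s.+1 t (ray v t), tder f p = g p.
  have : \forall p \near ijet s.+1 t (ray v t), U (jtrunc s p).
    apply: open_nbhs_nbhs; split; first exact: open_jtrunc.
    by rewrite /= jtrunc_ijet.
  by apply: filterS => p Up; apply: tderE; exact: df sf Up.
rewrite (near_eq_derive _ ng).
set p := ijet s t _ in Ut dA *; set J := ijet s.+1 0 _.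
have trp : jtrunc s (ijet s.+1 t (ray v t)) = p by rewrite jtrunc_ijet.
have dg : is_derive (ijet s.+1 t (ray v t)) J g
   ('D_(jtrunc s J) ('D_(ijet s 1 (fun=> 0)) f) (jtrunc s (ijet s.+1 t (ray v t))) +
     \sum_(k : 'I_s.+1 * 'I_2)
       (jcoord (next_coord k) (ijet s.+1 t (ray v t)) *
         'D_(jtrunc s J) (pder k.1 k.2 f) (jtrunc s (ijet s.+1 t (ray v t)))
       + pder k.1 k.2 f (jtrunc s (ijet s.+1 t (ray v t))) * jcoord (next_coord k) J)).
  apply: is_deriveD.
    by apply: is_derive_jtrunc; rewrite trp; apply: df => //; exact: sd.
  apply: is_derive_fsum => k; apply: is_derive_mul; first exact: is_derive_jcoord.
  by apply: is_derive_jtrunc; rewrite trp; apply: df => //; exact: sd.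
rewrite (@derive_val _ _ _ _ _ _ _ dg) trp /J jtrunc_ijet // => {dg}.
have -> : 'D_(ijet s 0 (phi t)) ('D_(ijet s 1 (fun=> 0)) f) p =
    \sum_(k : 'I_s.+1 * 'I_2)
      phi t k.1 0 k.2 * pder k.1 k.2 ('D_(ijet s 1 (fun=> 0)) f) p.
  apply: (etrans (derive_ijet 0 (phi t) (df _ _ (sd (ijet s 1 (fun=> 0))) Ut))).
  by rewrite mul0r add0r.
rewrite [RHS](_ : _ = \sum_(k : 'I_s.+1 * 'I_2)
      phi t k.1 0 k.2 * pder k.1 k.2 ('D_(ijet s 1 (fun=> 0)) f) p
  + \sum_(k : 'I_s.+1 * 'I_2) pder k.1 k.2 f p * phi t k.1.+1 0 k.2
  + \sum_(j : 'I_s.+1 * 'I_2) \sum_(k : 'I_s.+1 * 'I_2)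
     ray v t j.1.+1 0 j.2 * (phi t k.1 0 k.2 * pder k.1 k.2 (pder j.1 j.2 f) p)); last first.
  rewrite big_split /= [LHS]addrCA [LHS]addrC; congr (_ + _ + _).
    by apply: eq_bigr => k _; rewrite jcoord_ijet.
  apply: eq_bigr => j _; rewrite jcoord_ijet (derive_ijet _ _ (df _ _ (sd _) Ut)).
  by rewrite mul0r add0r mulr_sumr.
rewrite big_split /= addrAC; congr (_ + _).
have E (k : 'I_s.+1 * 'I_2) : 'D_e (pder k.1 k.2 f) p =
    pder k.1 k.2 ('D_(ijet s 1 (fun=> 0)) f) p + \sum_(j : 'I_s.+1 * 'I_2)
      ray v t j.1.+1 0 j.2 * pder k.1 k.2 (pder j.1 j.2 f) p.
  apply: (etrans (derive_ijet 1 (nth 0 [:: v]) (df (pder k.1 k.2 f) p (sd _) Ut))).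
  rewrite mul1r; apply: (congr2 +%R (derive_comm _ _ oU sf Ut)).
  apply: eq_bigr => j _; apply: (congr1 ( *%R _)).
  exact: (derive_comm _ _ oU sf Ut).
rewrite exchange_big -big_split /=; apply: eq_bigr => k _.
rewrite {}E mulrDr mulr_sumr; apply: (congr1 (+%R _)).
by apply: eq_bigr => j _; rewrite mulrCA.
Qed.

(** The boundary term of m integrations by parts of p_0 y_m, when [p k] and [y k] are the
    k-th derivatives of p_0 and y_0; see [is_derive_concomitant]. *)
Fixpoint concomitant m (p y : nat -> R -> R) (t : R) : R :=
  match m with
  | 0 => 0
  | m'.+1 => (-1) ^+ m'.+1 * (p 0%N t * y m' t) + concomitant m' (fun k => p k.+1) y t
  end.

Lemma is_derive_concomitant m (p y : nat -> R -> R) (t : R) :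
  (forall k, is_derive t (1 : R) (p k) (p k.+1 t)) ->
  (forall k, is_derive t (1 : R) (y k) (y k.+1 t)) ->
  is_derive t (1 : R) (concomitant m p y) ((-1) ^+ m * (p 0%N t * y m t) - p m t * y 0%N t).
Proof.
move=> hp hy; elim: m p hp => [|m IH] p hp /=.
  by rewrite mul1r subrr; exact: is_derive_cst.
have hc : is_derive t (1 : R) (fun=> (-1) ^+ m.+1 : R) (0 : R) by exact: is_derive_cst.
have h1 := is_derive_mul hc (is_derive_mul (hp 0%N) (hy m)).
apply: (is_derive_eq (is_deriveD h1 (IH _ (fun k => hp k.+1)))).
rewrite /= !exprS; ring.
Qed.

Lemma concomitant_eq0 m (p y : nat -> R -> R) (t : R) :
  (forall k, (k < m)%N -> p k t = 0) \/ (forall k, (k < m)%N -> y k t = 0) ->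
  concomitant m p y t = 0.
Proof.
elim: m p => [|m IH] p //= h; rewrite IH ?addr0.
  by case: h => h; rewrite h // ?mul0r ?mulr0.
by case: h => h; [left => k km; apply: h|right => k km; apply: h; exact: ltnW].
Qed.

(** The Euler-Lagrange expression of L, linearised along the uniform motion. *)
Definition linearized r (L : jet R r -> R) v (phi : R -> nat -> 'rV[R]_2) (i : 'I_2) t : R :=
  \sum_(m < r.+1) (-1) ^+ m * variation v (@tdern R m r (pder m i L)) phi t.

(** The Hessian of L at the jet of the uniform motion is symmetric. *)
Lemma variation_sym r (U : set (jet R r)) (L : jet R r -> R) v
    (phi psi : R -> nat -> 'rV[R]_2) t :
  open U -> smooth_on U L -> U (ijet r t (ray v t)) ->
  \sum_i \sum_(m < r.+1) psi t m 0 i * variation v (pder m i L) phi t =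
  \sum_i \sum_(m < r.+1) phi t m 0 i * variation v (pder m i L) psi t.
Proof.
move=> oU sL Ut.
have E (f g : R -> nat -> 'rV[R]_2) :
    \sum_i \sum_(m < r.+1) f t m 0 i * variation v (pder m i L) g t =
  \sum_(k : 'I_r.+1 * 'I_2) \sum_(j : 'I_r.+1 * 'I_2)
    f t k.1 0 k.2 * (g t j.1 0 j.2 *
      pder j.1 j.2 (pder k.1 k.2 L) (ijet r t (ray v t))).
  rewrite exchange_big (pair_bigA _ (fun (m : 'I_r.+1) (i : 'I_2) =>
    f t m 0 i * variation v (pder m i L) g t)) /=.
  apply: eq_bigr => k _; rewrite -mulr_sumr; apply: (congr1 ( *%R _)).
  apply: (etrans (derive_ijet _ _
    (smooth_differentiable (smooth_derive _ sL) Ut))).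
  by rewrite mul0r add0r.
apply: (etrans (E psi phi)); apply: (etrans _ (esym (E phi psi))).
rewrite exchange_big /=; apply: eq_bigr => j _; apply: eq_bigr => k _.
rewrite mulrCA; apply: (congr1 ( *%R _)); apply: (congr1 ( *%R _)).
exact: (derive_comm _ _ oU sL Ut).
Qed.

Lemma variation_tdern r (U : set (jet R r)) (f : jet R r -> R) v phi t n : open U ->
  smooth_on U f -> deriv_chain phi -> U (ijet r t (ray v t)) ->
  is_derive t (1 : R) (variation v (@tdern R n r f) phi)
    (variation v (@tdern R n.+1 r f) phi t).
Proof.
move=> oU sf hphi Ut.
apply: (@variation_tder v _ [set p : jet R (n + r) | U (jtrunc r p)]) => //.
- exact: open_jtrunc.
- exact: smooth_tdern.
- by rewrite /= jtrunc_ijet ?leq_addl.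
Qed.

(** The linearised Euler-Lagrange operator is formally self-adjoint. The boundary term is
    bilinear in the derivatives of phi and of psi: it vanishes at a because phi does to high
    order, and at b because psi does. *)
Lemma linearized_sym r (U : set (jet R r)) (L : jet R r -> R) v phi psi (a b : R) :
  open U -> smooth_on U L -> deriv_chain phi -> deriv_chain psi ->
  (forall t, a <= t <= b -> U (ijet r t (ray v t))) ->
  (forall n, (n <= r + r)%N -> phi a n = 0) ->
  (forall n, (n <= r + r)%N -> psi b n = 0) ->
  exists H : R -> R, [/\ H a = 0, H b = 0 & forall t, a <= t <= b ->
    is_derive t (1 : R) H (\sum_i (psi t 0%N 0 i * linearized L v phi i t
                             - phi t 0%N 0 i * linearized L v psi i t))].
Proof.
move=> oU sL hphi hpsi Uab phia psib.
pose C (f g : R -> nat -> 'rV[R]_2) (i : 'I_2) (m : 'I_r.+1) :=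
  concomitant m (fun k t => f t k 0 i) (fun n => variation v (@tdern R n r (pder m i L)) g).
pose H t := \sum_i \sum_(m < r.+1) (C psi phi i m t - C phi psi i m t).
have C0 (f g : R -> nat -> 'rV[R]_2) i m t :
   (forall n, (n <= r + r)%N -> f t n = 0) \/
   (forall n, (n <= r + r)%N -> g t n = 0) -> C f g i m t = 0.
  move=> h; apply: concomitant_eq0; case: h => h; [left|right] => k km.
    rewrite h ?mxE // (leq_trans (ltnW km)) // (leq_trans _ (leq_addr _ _)) //.
    by rewrite -ltnS.
  rewrite /variation (_ : ijet _ 0 (g t) = 0) ?derive0 //.
  rewrite (@eq_ijet _ _ _ _ (fun=> 0)).
    by congr (_, _); apply/matrixP => x y; rewrite !mxE.
  move=> n nkr; apply: h; rewrite (leq_trans nkr) // leq_add2r ltnW //.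
  by rewrite (leq_trans km) // -ltnS.
exists H; split.
- by rewrite /H !big1 // => i _; rewrite big1 // => m _; rewrite !C0 ?subrr; auto.
- by rewrite /H !big1 // => i _; rewrite big1 // => m _; rewrite !C0 ?subrr; auto.
move=> t tab; have Ut := Uab t tab.
have dC (f g : R -> nat -> 'rV[R]_2) i (m : 'I_r.+1) : deriv_chain f -> deriv_chain g ->
   is_derive t (1 : R) (C f g i m)
    ((-1) ^+ m * (f t 0%N 0 i * variation v (@tdern R m r (pder m i L)) g t)
      - f t m 0 i * variation v (pder m i L) g t).
  move=> hf hg; apply: is_derive_concomitant => k; first exact: hf.
  exact: (variation_tdern k oU (smooth_derive _ sL) hg Ut).
have dH : is_derive t (1 : R) H (\sum_i \sum_(m < r.+1)
   (((-1) ^+ m * (psi t 0%N 0 i * variation v (@tdern R m r (pder m i L)) phi t)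
      - psi t m 0 i * variation v (pder m i L) phi t) -
   ((-1) ^+ m * (phi t 0%N 0 i * variation v (@tdern R m r (pder m i L)) psi t)
      - phi t m 0 i * variation v (pder m i L) psi t))).
  apply: is_derive_fsum => i; apply: is_derive_fsum => m.
  exact: (is_deriveB (dC _ _ i m hpsi hphi) (dC _ _ i m hphi hpsi)).
apply: (is_derive_eq dH).
have := variation_sym phi psi oU sL Ut => S.
apply/eqP; rewrite -subr_eq0; apply/eqP.
rewrite -[RHS](subrr (\sum_i \sum_(m < r.+1) phi t m 0 i * variation v (pder m i L) psi t)).
rewrite -[in X in _ = _ - X]S -!sumrB; apply: eq_bigr => i _.
rewrite /linearized !mulr_sumr -!sumrB; apply: eq_bigr => m _.
have id (c x y X Y u w : R) : c * (x * X) - u - (c * (y * Y) - w)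
    - (x * (c * X) - y * (c * Y)) = w - u by ring.
exact: id.
Qed.

(** A Lagrangian that represents E near one jet is enough, because only the derivative of E
    along a family of motions through this jet is computed. *)
Lemma is_derive_linearized (E : jet R 3 -> 'rV[R]_2) r (U : set (jet R r))
    (L : jet R r -> R) v (phi : R -> nat -> 'rV[R]_2) i (t : R) :
  open U -> smooth_on U L -> U (ijet r t (ray v t)) -> 0 < lor v ->
  (forall t q i, U (ijet r t q) -> 0 < lor (q 1%N) ->
     E (ijet 3 t q) 0 i = euler_lagrange L i t q) ->
  is_derive (0 : R) (1 : R)
    (fun s => E (ijet 3 t (fun m => ray v t m + s *: phi t m)) 0 i)
    (linearized L v phi i t).
Proof.
move=> oU sL Ut v0 EL.
have line s (x : R) : ijet s t (fun m => ray v t m + x *: phi t m) =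
    x *: ijet s 0 (phi t) + ijet s t (ray v t).
  by rewrite ijetZ ijetD mulr0 add0r; apply: eq_ijet => m _; rewrite addrC.
have nE : \forall x \near (0 : R),
    euler_lagrange L i t (fun m => ray v t m + x *: phi t m) =
    E (ijet 3 t (fun m => ray v t m + x *: phi t m)) 0 i.
  have nU : \forall x \near (0 : R), U (ijet r t (fun m => ray v t m + x *: phi t m)).
    apply: near_open_preimage => //.
      by rewrite line scale0r add0r.
    rewrite (_ : (fun x => _) = (fun x => x *: ijet r 0 (phi t) + ijet r t (ray v t))).
      exact: line_continuous.
    by apply/funext => x; exact: line.
  have nT : \forall x \near (0 : R),
      timelike (ijet 3 t (fun m => ray v t m + x *: phi t m)).
    apply: (@near_open_preimage _ _ [set p : jet R 3 | timelike p]).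
    - exact: open_timelike.
    - by rewrite /= line scale0r add0r /timelike jrow_ijet.
    rewrite (_ : (fun x => _) = (fun x => x *: ijet 3 0 (phi t) + ijet 3 t (ray v t))).
      exact: line_continuous.
    by apply/funext => x; exact: line.
  apply: filterS2 nU nT => x Ux; rewrite /timelike jrow_ijet // => Tx.
  by rewrite EL.
apply: (near_eq_is_derive nE); apply: is_derive_fsum => m.
have hc : is_derive (0 : R) (1 : R) (fun=> (-1) ^+ m : R) (0 : R).
  exact: is_derive_cst.
have hd : is_derive (0 : R) (1 : R)
  (fun x : R => @tdern R m r (pder m i L)
     (ijet (m + r) t (fun n => ray v t n + x *: phi t n)))
  (variation v (@tdern R m r (pder m i L)) phi t).
  rewrite (_ : (fun x => _) = (fun x : R => @tdern R m r (pder m i L)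
     (x *: ijet (m + r) 0 (phi t) + ijet (m + r) t (ray v t)))); last first.
    by apply/funext => x; rewrite line.
  rewrite /variation -[X in 'D_ _ _ X]add0r.
  rewrite -[X in 'D_ _ _ (X + _)](scale0r (ijet (m + r) 0 (phi t))).
  apply: is_derive_line; apply: diff_derivable; rewrite scale0r add0r.
  apply: (@smooth_differentiable _ _ [set p : jet R (m + r) | U (jtrunc r p)]).
    by apply: smooth_tdern => //; exact: smooth_derive.
  by rewrite /= jtrunc_ijet // leq_addl.
apply: (is_derive_eq (is_derive_mul hc hd)).
by rewrite mulr0 addr0.
Qed.

(** The n-th derivative of (t - c)^N. *)
Definition pow_deriv (N : nat) (c : R) (n : nat) (t : R) : R :=
  (N ^_ n)%:R * (t - c) ^+ (N - n).

Lemma is_derive_pow_deriv N c n (t : R) :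
  is_derive t (1 : R) (pow_deriv N c n) (pow_deriv N c n.+1 t).
Proof.
have h0 : is_derive t (1 : R) (fun x : R => x - c) 1.
  have := is_deriveB (is_derive_id t (1 : R)) (is_derive_cst (c : R) t (1 : R)).
  by rewrite subr0.
have hc : is_derive t (1 : R) (fun=> (N ^_ n)%:R : R) (0 : R) by exact: is_derive_cst.
have hX : is_derive t (1 : R) (fun x : R => (x - c) ^+ (N - n))
    ((N - n)%:R * (t - c) ^+ (N - n).-1).
  have -> : (fun x : R => (x - c) ^+ (N - n)) = (fun x : R => x - c) ^+ (N - n).
    by apply/funext => x; rewrite exprfctE.
  apply: (is_derive_eq (is_deriveX (N - n) h0)).
  by rewrite /GRing.scale /= mulr1 -mulr_natl.
apply: (is_derive_eq (is_derive_mul hc hX)).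
by rewrite mulr0 addr0 /pow_deriv ffactnSr natrM mulrA subnS.
Qed.

Lemma pow_deriv0 N c n : (n < N)%N -> pow_deriv N c n c = 0.
Proof. by move=> nN; rewrite /pow_deriv subrr expr0n subn_eq0 leqNgt nN mulr0. Qed.

(** If E is variational, its linearisation is formally self-adjoint, which forces the
    coefficient B of the second derivative to be symmetric when A is constant along the motion.

    The test variations are f = t^N in the second coordinate and g = (t - b)^N in the first one,
    each vanishing to high order at one end of [0, b]. Integrating by parts, the self-adjointness
    identity of [linearized_sym] says that (B_21 - B_12) f' g' is the derivative of a function
    that vanishes at both ends; as f' g' has no zero inside, Rolle's theorem gives B_12 = B_21. *)
Lemma helmholtz (E : jet R 3 -> 'rV[R]_2) v (A B : 'M[R]_2) :
  euler_poisson E -> 0 < lor v -> A 0 1 = - A 1 0 ->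
  (forall t (phi : nat -> 'rV[R]_2) i, is_derive (0 : R) (1 : R)
     (fun s => E (ijet 3 t (fun m => ray v t m + s *: phi m)) 0 i)
     (\sum_j A i j * phi 3%N 0 j + \sum_j B i j * phi 2%N 0 j)) ->
  B 0 1 = B 1 0.
Proof.
move=> EP v0 Askew Elin.
have [r [U [L [oU U0 sL EL]]]] := EP 0 (ray v 0) v0.
have [b b0 Ub] : exists2 b : R, 0 < b & forall t, 0 <= t <= b -> U (ijet r t (ray v t)).
  have : \forall t \near (0 : R), U (ijet r t (ray v t)).
    apply: near_open_preimage => //.
    rewrite (_ : (fun t => _) = (fun t => t *: ijet r 1 (nth 0 [:: v]) +
      ijet r 0 (nth 0 [:: 0; v]))).
      exact: line_continuous.
    by apply/funext => t; exact: ijet_ray.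
  move=> /nbhs_ballP [e /= e0 He]; exists (e / 2); first by rewrite divr_gt0.
  move=> t /andP[t0 te]; apply: He; rewrite /ball /= sub0r normrN ger0_norm //.
  by apply: le_lt_trans te _; rewrite ltr_pdivrMr // ltr_pMr // ltr1n.
(* Order > 2 r kills the boundary terms of [linearized_sym], order > 2 those of K below. *)
pose N := (r + r).+3.
have N2 n : (n <= r + r)%N -> (n < N)%N by move=> nr; rewrite ltnS ltnW // ltnS ltnW // ltnS.
pose f := pow_deriv N 0; pose g := pow_deriv N b.
pose phi (t : R) (n : nat) : 'rV[R]_2 := f n t *: delta_mx 0 1.
pose psi (t : R) (n : nat) : 'rV[R]_2 := g n t *: delta_mx 0 0.
have hf n t : is_derive t (1 : R) (f n) (f n.+1 t) by exact: is_derive_pow_deriv.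
have hg n t : is_derive t (1 : R) (g n) (g n.+1 t) by exact: is_derive_pow_deriv.
have chain (h : nat -> R -> R) k : (forall n t, is_derive t (1 : R) (h n) (h n.+1 t)) ->
    deriv_chain (fun t n => h n t *: (delta_mx 0 k : 'rV[R]_2)).
  move=> hh t m i; rewrite !mxE.
  rewrite (_ : (fun x => _) = (fun x : R => h m x * ((0 == 0 :> 'I_1) && (i == k))%:R)).
    have hc : is_derive t (1 : R) (fun=> ((0 == 0 :> 'I_1) && (i == k))%:R : R) (0 : R).
      exact: is_derive_cst.
    apply: (is_derive_eq (is_derive_mul (hh m t) hc)).
    by rewrite mulr0 add0r mulrC.
  by apply/funext => x; rewrite !mxE.
have [H [Ha Hb dH]] := @linearized_sym r U L v phi psi 0 b oU sL (chain f 1 hf)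
  (chain g 0 hg) Ub (fun n nN => ltac:(by rewrite /phi /f pow_deriv0 ?scale0r // N2))
  (fun n nN => ltac:(by rewrite /psi /g pow_deriv0 ?scale0r // N2)).
have lin ph t i : 0 <= t <= b -> linearized L v ph i t =
    \sum_j A i j * ph t 3%N 0 j + \sum_j B i j * ph t 2%N 0 j.
  move=> tb.
  have d1 := is_derive_linearized ph i oU sL (Ub t tb) v0 EL.
  have d2 := Elin t (ph t) i.
  by rewrite -(@derive_val _ _ _ _ _ _ _ d1) -(@derive_val _ _ _ _ _ _ _ d2).
(* What is subtracted are the boundary terms for g f''' + f g''', g f'' and f g''. *)
pose K t := H t - A 0 1 * (g 0%N t * f 2%N t - g 1%N t * f 1%N t + g 2%N t * f 0%N t)
  - B 0 1 * (g 0%N t * f 1%N t) + B 1 0 * (f 0%N t * g 1%N t).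
have dK t : 0 <= t <= b -> is_derive t (1 : R) K ((B 1 0 - B 0 1) * (f 1%N t * g 1%N t)).
  move=> tb.
  have hc (c : R) : is_derive t (1 : R) (fun=> c : R) (0 : R) by exact: is_derive_cst.
  have dm k l := is_derive_mul (hg k t) (hf l t).
  have := is_deriveD (is_deriveB (is_deriveB (dH t tb)
    (is_derive_mul (hc (A 0 1)) (is_deriveD (is_deriveB (dm 0%N 2%N) (dm 1%N 1%N)) (dm 2%N 0%N))))
    (is_derive_mul (hc (B 0 1)) (dm 0%N 1%N)))
    (is_derive_mul (hc (B 1 0)) (is_derive_mul (hf 0%N t) (hg 1%N t))).
  move=> dd; apply: (is_derive_eq dd).
  rewrite !sum2 !lin // !sum2 /phi /psi !mxE /= Askew.
  ring.
have f0 n : (n <= 2)%N -> f n 0 = 0.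
  by move=> nN; apply: pow_deriv0; rewrite ltnS (leq_trans nN).
have g0 n : (n <= 2)%N -> g n b = 0.
  by move=> nN; apply: pow_deriv0; rewrite ltnS (leq_trans nN).
have K0 : K 0 = 0 by rewrite /K Ha !f0 //; ring.
have Kb : K b = 0 by rewrite /K Hb !g0 //; ring.
have inb x : x \in `]0, b[%R -> 0 <= x <= b.
  by rewrite in_itv /= => /andP[x0 xb]; rewrite !ltW.
have [|||x xI dx] := @Rolle R K 0 b b0.
- by move=> x /inb /dK [].
- apply: derivable_within_continuous => x; rewrite in_itv /= => /dK [] //.
- by rewrite K0 Kb.
have := @derive_val _ _ _ _ _ _ _ (dK x (inb x xI)).
rewrite (@derive_val _ _ _ _ _ _ _ dx) => /esym/eqP.
have [x0 xb] : 0 < x /\ x < b by move: xI; rewrite in_itv /= => /andP.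
have fx : f 1%N x != 0.
  by rewrite /f /pow_deriv ffactn1 subr0 mulf_neq0 ?pnatr_eq0 // expf_neq0 ?gt_eqF.
have gx : g 1%N x != 0.
  by rewrite /g /pow_deriv ffactn1 mulf_neq0 ?pnatr_eq0 // expf_neq0 // subr_eq0 lt_eqF.
by rewrite mulf_eq0 subr_eq0 mulf_eq0 (negbTE fx) (negbTE gx) !orbF => /eqP.
Qed.

End Helmholtz.

(** * The invariance identity in components *)

Section LieDerivative.
Context {R : realType}.

(** The value on w of the differential of [lorentz pi om] at p. *)
Definition dlorentz (pi : 'rV[R]_2) (om : R) (p w : jet R 2) : jet R 2 :=
  ijet 2 (- dot pi (jrow 0 w))
    (nth 0 [:: w.1 *: pi + om *: rot (jrow 0 w);
       dot pi (jrow 1 w) *: jrow 1 p + dot pi (jrow 1 p) *: jrow 1 w + om *: rot (jrow 1 w);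
       (2 * dot pi (jrow 1 w)) *: jrow 2 p + (2 * dot pi (jrow 1 p)) *: jrow 2 w
       + dot pi (jrow 2 w) *: jrow 1 p + dot pi (jrow 2 p) *: jrow 1 w
       + om *: rot (jrow 2 w)]).

Lemma derive_lorentz pi om (p w : jet R 2) :
  'D_w (lorentz pi om) p = dlorentz pi om p w.
Proof.
apply: (@derive_quadratic _ _ _ _ _ _ _ (ijet 2 0
  (nth 0 [:: 0; dot pi (jrow 1 w) *: jrow 1 w;
    (2 * dot pi (jrow 1 w)) *: jrow 2 w + dot pi (jrow 2 w) *: jrow 1 w]))) => h.
rewrite /lorentz /dlorentz !jrow_linear /=.
move: (jrow 0 p) (jrow 1 p) (jrow 2 p) (jrow 0 w) (jrow 1 w) (jrow 2 w).
move=> x v v' w0 w1 w2; congr (_, _).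
  rewrite !dotE !mxE /= /GRing.scale /=; ring.
apply/matrixP => m; apply: ord2P; case: m => -[|[|[|m]]] hm //;
  rewrite !mxE /= ?mxE ?dotE ?mxE /GRing.scale /=; ring.
Qed.

Lemma lie_eform (A : jet R 1 -> 'M[R]_2) (k : jet R 2 -> 'rV[R]_2) pi om (p w : jet R 2) i :
  (forall j, differentiable (fun z => A z i j) (jtrunc 1 p)) ->
  differentiable (fun y => k y 0 i) p ->
  lie_derivative (lorentz pi om) (eform A k i) p w =
    \sum_j 'D_(jtrunc 1 (lorentz pi om p)) (fun z => A z i j) (jtrunc 1 p) * jrow 2 w 0 j
    + 'D_(lorentz pi om p) (fun y => k y 0 i) p * w.1
    + eform A k i p (dlorentz pi om p w).
Proof.
move=> dA dk; rewrite /lie_derivative derive_lorentz; congr (_ + _).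
have hc (c : R) : is_derive p (lorentz pi om p) (fun=> c : R) (0 : R).
  exact: is_derive_cst.
have d1 : is_derive p (lorentz pi om p)
   (fun y => \sum_j A (jtrunc 1 y) i j * jrow 2 w 0 j)
   (\sum_j 'D_(jtrunc 1 (lorentz pi om p)) (fun z => A z i j) (jtrunc 1 p) * jrow 2 w 0 j).
  apply: is_derive_fsum => j.
  apply: (is_derive_eq (is_derive_mul (is_derive_jtrunc _ (dA j)) (hc _))).
  by rewrite mulr0 add0r mulrC.
have d2 := is_deriveD d1 (is_derive_mul (is_derive_diff (lorentz pi om p) dk) (hc w.1)).
apply: (etrans (@derive_val _ _ _ _ _ _ _ d2)).
by rewrite mulr0 add0r [w.1 * _]mulrC.
Qed.

(** Base points with t = 0 and x = 0: there the Lorentz generator has neither t- nor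
    x-components, see [lorentz_vajet]. *)
Definition vjet (v : 'rV[R]_2) : jet R 1 := ijet 1 0 (nth 0 [:: 0; v]).
Definition vajet (v v' : 'rV[R]_2) : jet R 2 := ijet 2 0 (nth 0 [:: 0; v; v']).

Lemma jtrunc_vajet v v' : jtrunc 1 (vajet v v') = vjet v.
Proof. by rewrite jtrunc_ijet //; apply: eq_ijet => -[|[|m]]. Qed.

Definition lorentz_vel (pi : 'rV[R]_2) (om : R) v := pi + dot pi v *: v + om *: rot v.
Definition lorentz_acc (pi : 'rV[R]_2) (om : R) v v' :=
  (2 * dot pi v) *: v' + dot pi v' *: v + om *: rot v'.

Lemma lorentz_vajet pi om v v' :
  lorentz pi om (vajet v v') = vajet (lorentz_vel pi om v) (lorentz_acc pi om v v').
Proof.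
rewrite /lorentz /lorentz_vel /lorentz_acc !jrow_ijet //=; congr (_, _).
  by rewrite dotE !mxE !mulr0 addr0 !oppr0.
apply/matrixP => m; apply: ord2P; case: m => -[|[|[|m]]] hm //;
  rewrite !mxE /= ?mxE /GRing.scale /=; ring.
Qed.

(** How the generator acts on accelerations: the derivative of [lorentz_acc pi om v v'] with
    respect to v'. *)
Definition lorentz_mx (pi : 'rV[R]_2) (om : R) v : 'M[R]_2 :=
  \matrix_(j, l) (2 * dot pi v * (j == l)%:R - v 0 j * pi 0 l
     + om * ((l < j)%N%:R - (j < l)%N%:R)).

(** Xi and Pi are eliminated by evaluating the identity on vectors that the contact forms
    annihilate: those along v', and (1, v, v', 0). *)
Lemma lorentz_test_vectors (D : 'I_2 -> R) (Dk : R) (A F X P : 'M[R]_2) (k : 'rV[R]_2)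
    (i : 'I_2) pi om v v' :
  (forall w : jet R 2, \sum_j D j * jrow 2 w 0 j + Dk * w.1
     + (\sum_j A i j * jrow 2 (dlorentz pi om (vajet v v') w) 0 j
        + k 0 i * (dlorentz pi om (vajet v v') w).1) =
     \sum_j F i j * (\sum_l A j l * jrow 2 w 0 l + k 0 j * w.1)
      + \sum_j X i j * contact 0 j (vajet v v') w
      + \sum_j P i j * contact 1 j (vajet v v') w) ->
  (forall l, D l + \sum_j A i j * lorentz_mx pi om v j l = \sum_j F i j * A j l) /\
  Dk = \sum_j F i j * k 0 j + k 0 i * dot pi v - 3 * dot pi v' * \sum_j A i j * v' 0 j.
Proof.
move=> H; split.
  apply: ord2P; [have := H (ijet 2 0 (nth 0 [:: 0; 0; delta_mx 0 0]))
    |have := H (ijet 2 0 (nth 0 [:: 0; 0; delta_mx 0 1]))];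
    rewrite /contact /dlorentz !jrow_ijet //= !sum2 !dotE !mxE /=;
    rewrite !mulr0 !mulr1 !add0r !addr0 !dotE => h;
    apply: (eq_from h); ring.
have h := H (ijet 2 1 (nth 0 [:: v; v'; 0])); move: h.
rewrite /contact /dlorentz !jrow_ijet //= !sum2 !dotE !mxE /= ?dotE => h.
apply: (eq_from h); ring.
Qed.

Lemma lorentz_equations (A : jet R 1 -> 'M[R]_2) (k : jet R 2 -> 'rV[R]_2) :
  lorentz_invariant A k -> forall pi om v v', 0 < lor v ->
  (forall i j, differentiable (fun z => A z i j) (vjet v)) ->
  (forall i, differentiable (fun y => k y 0 i) (vajet v v')) ->
  exists Phi : 'M[R]_2, forall i,
    (forall l, 'D_(vjet (lorentz_vel pi om v)) (fun z => A z i l) (vjet v)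
       + \sum_j A (vjet v) i j * lorentz_mx pi om v j l = \sum_j Phi i j * A (vjet v) j l) /\
    'D_(vajet (lorentz_vel pi om v) (lorentz_acc pi om v v')) (fun y => k y 0 i) (vajet v v')
      = \sum_j Phi i j * k (vajet v v') 0 j + k (vajet v v') 0 i * dot pi v
        - 3 * dot pi v' * \sum_j A (vjet v) i j * v' 0 j.
Proof.
move=> LI pi om v v' v0 dA dk; have [Phi [Xi [Pi H]]] := LI pi om.
have tP : timelike (vajet v v') by rewrite /timelike jrow_ijet.
have trP := jtrunc_vajet v v'.
have E0 : jrow 0 (vajet v v') = 0 by rewrite jrow_ijet.
have E1 : jrow 1 (vajet v v') = v by rewrite jrow_ijet.
have E2 : jrow 2 (vajet v v') = v' by rewrite jrow_ijet.
pose F := Phi (jrow 1 (vajet v v')) (jrow 2 (vajet v v')).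
pose X := Xi (jrow 1 (vajet v v')) (jrow 2 (vajet v v')).
pose P := Pi (jrow 1 (vajet v v')) (jrow 2 (vajet v v')).
exists F => i.
have {}H w :
    \sum_j 'D_(vjet (lorentz_vel pi om v)) (fun z => A z i j) (vjet v) * jrow 2 w 0 j
    + 'D_(vajet (lorentz_vel pi om v) (lorentz_acc pi om v v')) (fun y => k y 0 i) (vajet v v')
      * w.1
    + eform A k i (vajet v v') (dlorentz pi om (vajet v v') w) =
      \sum_j F i j * eform A k j (vajet v v') w
      + \sum_j X i j * contact 0 j (vajet v v') w
      + \sum_j P i j * contact 1 j (vajet v v') w.
  have dA' j : differentiable (fun z => A z i j) (jtrunc 1 (vajet v v')) by rewrite trP.
  have hl := lie_eform pi om w dA' (dk i).
  rewrite trP lorentz_vajet jtrunc_vajet in hl.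
  exact: (etrans (esym hl) (H _ tP i w)).
rewrite /eform trP in H.
exact: (lorentz_test_vectors
  (D := fun j => 'D_(vjet (lorentz_vel pi om v)) (fun z => A z i j) (vjet v)) H).
Qed.

End LieDerivative.

Section ForceCoefficient.
Context {R : realType} (A B : jet R 1 -> 'M[R]_2) (c : jet R 1 -> 'rV[R]_2)
  (sA : forall i j, smooth_on (@timelike R 1) (fun z => A z i j))
  (sB : forall i j, smooth_on (@timelike R 1) (fun z => B z i j))
  (sc : forall i, smooth_on (@timelike R 1) (fun z => c z 0 i)).
Implicit Types (v u : 'rV[R]_2).

Lemma kcoef_vajet v (v' : 'rV[R]_2) i :
  kcoef A B c (vajet v v') 0 i = \sum_j \sum_l
     v' 0 l * pder (inord 1) l (fun y => A y i j) (vjet v) * v' 0 j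
   + \sum_j B (vjet v) i j * v' 0 j + c (vjet v) 0 i.
Proof. by rewrite /kcoef jtrunc_vajet mxE jrow_ijet. Qed.

Lemma timelike_vjet v : 0 < lor v -> timelike (vjet v).
Proof. by rewrite /timelike jrow_ijet. Qed.

Lemma differentiable_kcoef p0 i : timelike p0 ->
  differentiable (fun p => kcoef A B c p 0 i) p0.
Proof.
move=> tp; have tv : timelike (jtrunc 1 p0) by rewrite /timelike jrow_jtrunc.
have -> : (fun p => kcoef A B c p 0 i) = (fun p => \sum_j \sum_l
     jrow 2 p 0 l * pder (inord 1) l (fun y => A y i j) (jtrunc 1 p) * jrow 2 p 0 j
   + \sum_j B (jtrunc 1 p) i j * jrow 2 p 0 j + c (jtrunc 1 p) 0 i).
  by apply/funext => p; rewrite mxE.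
have d (f : jet R 1 -> R) : smooth_on (@timelike R 1) f ->
    differentiable (fun p => f (jtrunc 1 p)) p0.
  move=> sf; apply: differentiable_jtrunc.
  exact: smooth_differentiable sf tv.
apply: differentiableD; last exact: (d (fun z => c z 0 i)).
apply: differentiableD; apply: differentiable_fsum => j.
  apply: differentiable_fsum => l; apply: differentiableM.
    apply: differentiableM; first exact: differentiable_jrow.
    apply: (d (pder (inord 1) l (fun y => A y i j))); exact: smooth_derive.
  exact: differentiable_jrow.
apply: differentiableM; first exact: (d (fun z => B z i j)).
exact: differentiable_jrow.
Qed.

Lemma derive_kcoef v v' u u' i : 0 < lor v ->
  'D_(vajet u u') (fun p => kcoef A B c p 0 i) (vajet v v') =
   \sum_j \sum_l
     (v' 0 l * pder (inord 1) l (fun y => A y i j) (vjet v) * u' 0 j +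
      v' 0 j * (v' 0 l * 'D_(vjet u) (pder (inord 1) l (fun y => A y i j)) (vjet v)
        + pder (inord 1) l (fun y => A y i j) (vjet v) * u' 0 l))
   + \sum_j (B (vjet v) i j * u' 0 j + v' 0 j * 'D_(vjet u) (fun z => B z i j) (vjet v))
   + 'D_(vjet u) (fun z => c z 0 i) (vjet v).
Proof.
move=> /timelike_vjet tv.
have -> : (fun p => kcoef A B c p 0 i) = (fun p => \sum_j \sum_l
     jrow 2 p 0 l * pder (inord 1) l (fun y => A y i j) (jtrunc 1 p) * jrow 2 p 0 j
   + \sum_j B (jtrunc 1 p) i j * jrow 2 p 0 j + c (jtrunc 1 p) 0 i).
  by apply/funext => p; rewrite mxE.
have d (f : jet R 1 -> R) : smooth_on (@timelike R 1) f ->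
    is_derive (vajet v v') (vajet u u') (fun p => f (jtrunc 1 p)) ('D_(vjet u) f (vjet v)).
  move=> sf; rewrite -(jtrunc_vajet v v') -(jtrunc_vajet u u').
  apply: is_derive_jtrunc; rewrite jtrunc_vajet.
  exact: smooth_differentiable sf tv.
have E1 : jrow 2 (vajet v v') = v' by rewrite jrow_ijet.
have E2 : jrow 2 (vajet u u') = u' by rewrite jrow_ijet.
have T := jtrunc_vajet v v'.
have r l : is_derive (vajet v v') (vajet u u') (fun y => jrow 2 y 0 l) (u' 0 l).
  by have := @is_derive_jrow R 2 2 l (vajet v v') (vajet u u'); rewrite E2.
have sG l j : smooth_on (@timelike R 1) (pder (inord 1) l (fun y => A y i j)).
  exact: smooth_derive.
have dd := is_deriveD (is_deriveD
  (is_derive_fsum (fun j => is_derive_fsum (fun l =>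
    is_derive_mul (is_derive_mul (r l) (d _ (sG l j))) (r j))))
  (is_derive_fsum (fun j => is_derive_mul (d _ (sB i j)) (r j))))
  (d _ (sc i)).
rewrite (@derive_val _ _ _ _ _ _ _ dd) E1 T.
by [].
Qed.

End ForceCoefficient.

(** One row of k and of its derivative: as A is skew-symmetric, G l n = dA_nn/dv^l vanishes and
    a single entry of A remains. *)
Lemma skew_row (R : realType) (G dG : 'I_2 -> 'I_2 -> R) (v' u' b db a d : 'I_2 -> R)
    (c dc : R) (n o : 'I_2) : (n == 0) && (o == 1) || (n == 1) && (o == 0) ->
  (forall l, G l n = 0) -> (forall l, dG l n = 0) ->
  (forall l, G l o = a l) -> (forall l, dG l o = d l) ->
  \sum_j \sum_l v' l * G l j * v' j + \sum_j b j * v' j + c =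
    (v' 0 * a 0 + v' 1 * a 1) * v' o + (b 0 * v' 0 + b 1 * v' 1) + c /\
  \sum_j \sum_l (v' l * G l j * u' j + v' j * (v' l * dG l j + G l j * u' l))
  + \sum_j (b j * u' j + v' j * db j) + dc =
    (v' 0 * d 0 + v' 1 * d 1 + (u' 0 * a 0 + u' 1 * a 1)) * v' o
    + (v' 0 * a 0 + v' 1 * a 1) * u' o
    + (b 0 * u' 0 + b 1 * u' 1) + (db 0 * v' 0 + db 1 * v' 1) + dc.
Proof.
move=> H Gn dGn Go dGo; rewrite !sum2.
by case/orP: H => /andP [/eqP en /eqP eo]; subst n o;
  rewrite !Gn !dGn !Go !dGo; split; ring.
Qed.

Section InvariantForm.
Context {R : realType} (E : jet R 3 -> 'rV[R]_2) (A B : jet R 1 -> 'M[R]_2)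
  (c : jet R 1 -> 'rV[R]_2) (form : third_order_form E A B c)
  (LI : lorentz_invariant A (kcoef A B c)).
Implicit Types (v u : 'rV[R]_2).

Local Notation k := (kcoef A B c).

Lemma smoothA i j : smooth_on (@timelike R 1) (fun z => A z i j).
Proof. by case: form. Qed.
Lemma smoothB i j : smooth_on (@timelike R 1) (fun z => B z i j).
Proof. by case: form. Qed.
Lemma smoothc i : smooth_on (@timelike R 1) (fun z => c z 0 i).
Proof. by case: form. Qed.

Lemma skewA (z : jet R 1) : timelike z ->
  [/\ A z 0 0 = 0, A z 1 1 = 0, A z 1 0 = - A z 0 1 & A z 0 1 != 0].
Proof.
move=> tz; have [_ _ _ /(_ z tz) [sk An0] _] := form.
have {}sk i j : A z j i = - A z i j by have /matrixP /(_ i j) := sk; rewrite !mxE.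
have d i : A z i i = 0.
  by apply/eqP; have /eqP := sk i i; rewrite -addr_eq0 -mulr2n mulrn_eq0.
split => //; apply: contraNneq An0 => A01.
apply/eqP/matrixP; apply: ord2P; apply: ord2P; rewrite mxE ?d //.
by rewrite sk A01 oppr0.
Qed.

Lemma vjet0 : vjet (0 : 'rV[R]_2) = 0.
Proof.
congr (_, _); apply/matrixP => m i; rewrite !mxE.
by case: m => -[|[|m]] hm //=; rewrite mxE.
Qed.

Lemma derive_vjet v u (f : jet R 1 -> R) : differentiable f (vjet v) ->
  'D_(vjet u) f (vjet v) = u 0 0 * pder (inord 1) 0 f (vjet v)
                     + u 0 1 * pder (inord 1) 1 f (vjet v).
Proof.
move=> df; have -> : vjet u = u 0 0 *: ((0, delta_mx (inord 1) 0) : jet R 1)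
    + u 0 1 *: ((0, delta_mx (inord 1) 1) : jet R 1).
  transitivity ((u 0 0 * 0 + u 0 1 * 0, u 0 0 *: delta_mx (inord 1) 0
    + u 0 1 *: delta_mx (inord 1) 1) : jet R 1); last by [].
  congr (_, _); first by rewrite !mulr0 addr0.
  have -> : inord 1 = 1 :> 'I_2 by apply/val_inj; rewrite /= inordK.
  apply/matrixP; apply: ord2P; apply: ord2P;
    rewrite !mxE /= ?mxE ?mulr0 ?mulr1 ?addr0 ?add0r //.
by rewrite deriveE // linearD !linearZ /= -!deriveE.
Qed.

Lemma derive_A_diag (z w : jet R 1) i : timelike z -> 'D_w (fun z => A z i i) z = 0.
Proof.
move=> tz; rewrite -[RHS](derive_cst (0 : R) z w); apply: near_eq_derive.
by apply: near_timelike => // y /skewA []; move: i; apply: ord2P.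
Qed.

Lemma derive_A_skew (z w : jet R 1) : timelike z ->
  'D_w (fun z => A z 1 0) z = - 'D_w (fun z => A z 0 1) z.
Proof.
move=> tz.
have -> : 'D_w (fun z => A z 1 0) z = 'D_w (- (fun z => A z 0 1)) z.
  by apply: near_eq_derive; apply: near_timelike => // y /skewA [].
by apply: deriveN; apply: diff_derivable; exact: smooth_differentiable (smoothA 0 1) tz.
Qed.

Lemma pder_A_diag (z : jet R 1) m l i : timelike z ->
  pder m l (fun z => A z i i) z = 0.
Proof. exact: derive_A_diag. Qed.

Lemma pder_A_skew (z : jet R 1) m l : timelike z ->
  pder m l (fun z => A z 1 0) z = - pder m l (fun z => A z 0 1) z.
Proof. exact: derive_A_skew. Qed.

Lemma derive2_A_diag (z w w' : jet R 1) i : timelike z ->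
  'D_w' ('D_w (fun z => A z i i)) z = 0.
Proof.
move=> tz; rewrite -[RHS](derive_cst (0 : R) z w'); apply: near_eq_derive.
by apply: near_timelike => // y ty; exact: derive_A_diag.
Qed.

Lemma derive2_A_skew (z w w' : jet R 1) : timelike z ->
  'D_w' ('D_w (fun z => A z 1 0)) z = - 'D_w' ('D_w (fun z => A z 0 1)) z.
Proof.
move=> tz.
have -> : 'D_w' ('D_w (fun z => A z 1 0)) z = 'D_w' (- 'D_w (fun z => A z 0 1)) z.
  by apply: near_eq_derive; apply: near_timelike => // y ty; exact: derive_A_skew.
apply: deriveN; apply: diff_derivable.
exact: smooth_differentiable (smooth_derive w (smoothA 0 1)) tz.
Qed.

Lemma derive_pder_A_diag (z w' : jet R 1) m l i : timelike z ->
  'D_w' (pder m l (fun z => A z i i)) z = 0.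
Proof. exact: derive2_A_diag. Qed.

Lemma derive_pder_A_skew (z w' : jet R 1) m l : timelike z ->
  'D_w' (pder m l (fun z => A z 1 0)) z = - 'D_w' (pder m l (fun z => A z 0 1)) z.
Proof. exact: derive2_A_skew. Qed.

Lemma kcoef_skew v v' u u' : 0 < lor v ->
  let a l := pder (inord 1) l (fun z => A z 0 1) (vjet v) in
  let d l := 'D_(vjet u) (pder (inord 1) l (fun z => A z 0 1)) (vjet v) in
  let b i j := B (vjet v) i j in
  let db i j := 'D_(vjet u) (fun z => B z i j) (vjet v) in
  [/\ k (vajet v v') 0 0 = (v' 0 0 * a 0 + v' 0 1 * a 1) * v' 0 1
        + (b 0 0 * v' 0 0 + b 0 1 * v' 0 1) + c (vjet v) 0 0,
      k (vajet v v') 0 1 = (v' 0 0 * - a 0 + v' 0 1 * - a 1) * v' 0 0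
        + (b 1 0 * v' 0 0 + b 1 1 * v' 0 1) + c (vjet v) 0 1,
      'D_(vajet u u') (fun p => k p 0 0) (vajet v v') =
    (v' 0 0 * d 0 + v' 0 1 * d 1 + (u' 0 0 * a 0 + u' 0 1 * a 1)) * v' 0 1
    + (v' 0 0 * a 0 + v' 0 1 * a 1) * u' 0 1
    + (b 0 0 * u' 0 0 + b 0 1 * u' 0 1)
    + (db 0 0 * v' 0 0 + db 0 1 * v' 0 1) + 'D_(vjet u) (fun z => c z 0 0) (vjet v) &
      'D_(vajet u u') (fun p => k p 0 1) (vajet v v') =
    (v' 0 0 * - d 0 + v' 0 1 * - d 1 + (u' 0 0 * - a 0 + u' 0 1 * - a 1)) * v' 0 0
    + (v' 0 0 * - a 0 + v' 0 1 * - a 1) * u' 0 0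
    + (b 1 0 * u' 0 0 + b 1 1 * u' 0 1)
    + (db 1 0 * v' 0 0 + db 1 1 * v' 0 1) + 'D_(vjet u) (fun z => c z 0 1) (vjet v)].
Proof.
move=> v0 a d b db; have tv := timelike_vjet v0.
have [K0 D0] := @skew_row R (fun l j => pder (inord 1) l (fun z => A z 0 j) (vjet v))
  (fun l j => 'D_(vjet u) (pder (inord 1) l (fun z => A z 0 j)) (vjet v))
  (v' 0) (u' 0) (b 0) (db 0) a d (c (vjet v) 0 0) ('D_(vjet u) (fun z => c z 0 0) (vjet v))
  0 1 isT (fun l => pder_A_diag _ _ 0 tv) (fun l => derive_pder_A_diag _ _ _ 0 tv)
  (fun l => erefl) (fun l => erefl).
have [K1 D1] := @skew_row R (fun l j => pder (inord 1) l (fun z => A z 1 j) (vjet v))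
  (fun l j => 'D_(vjet u) (pder (inord 1) l (fun z => A z 1 j)) (vjet v))
  (v' 0) (u' 0) (b 1) (db 1) (fun l => - a l) (fun l => - d l)
  (c (vjet v) 0 1) ('D_(vjet u) (fun z => c z 0 1) (vjet v))
  1 0 isT (fun l => pder_A_diag _ _ 1 tv) (fun l => derive_pder_A_diag _ _ _ 1 tv)
  (fun l => pder_A_skew _ _ tv) (fun l => derive_pder_A_skew _ _ _ tv).
split.
- exact: (etrans (kcoef_vajet A B c v v' 0) K0).
- exact: (etrans (kcoef_vajet A B c v v' 1) K1).
- exact: (etrans (derive_kcoef smoothA smoothB smoothc v' u u' 0 v0) D0).
- exact: (etrans (derive_kcoef smoothA smoothB smoothc v' u u' 1 v0) D1).
Qed.

(** The first identity of [lorentz_equations] determines Phi, because A is a times the standard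
    skew-symmetric matrix and a does not vanish. The second one then says how the generator
    acts on k; it is stated after multiplication by a. *)
Lemma lorentz_components pi om v v' : 0 < lor v ->
  let u := lorentz_vel pi om v in let u' := lorentz_acc pi om v v' in
  let M := lorentz_mx pi om v in
  let a := A (vjet v) 0 1 in let Da := 'D_(vjet u) (fun z => A z 0 1) (vjet v) in
  let k0 := k (vajet v v') 0 0 in let k1 := k (vajet v v') 0 1 in
  a * 'D_(vajet u u') (fun p => k p 0 0) (vajet v v') =
    (Da + a * M 1 1) * k0 - a * M 1 0 * k1 + a * k0 * dot pi v
      - 3 * dot pi v' * a * a * v' 0 1 /\
  a * 'D_(vajet u u') (fun p => k p 0 1) (vajet v v') =
    - a * M 0 1 * k0 + (Da + a * M 0 0) * k1 + a * k1 * dot pi v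
      + 3 * dot pi v' * a * a * v' 0 0.
Proof.
move=> v0 u u' M a Da k0 k1; have tv := timelike_vjet v0.
have dA i j : differentiable (fun z => A z i j) (vjet v).
  exact: smooth_differentiable (smoothA i j) tv.
have dk i : differentiable (fun y => k y 0 i) (vajet v v').
  apply: (differentiable_kcoef smoothA smoothB smoothc).
  by rewrite /timelike jrow_ijet.
have [Phi H] := lorentz_equations LI pi om v0 dA dk.
have [/[dup] /(_ 0) + /(_ 1)] := H 0; have [/[dup] /(_ 0) + /(_ 1)] := H 1.
rewrite -/u -/u' -/M !sum2 !derive_A_diag // !derive_A_skew // -/Da -/k0 -/k1.
have [-> -> ->] := skewA tv; rewrite -/a => a0.
move: ('D_(vajet u u') (fun p => k p 0 0) (vajet v v'))
  ('D_(vajet u u') (fun p => k p 0 1) (vajet v v')).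
move=> D0 D1 e10 e11 eD1 e00 e01 eD0.
have p00 : a * Phi 0 0 = Da + a * M 1 1 by apply: (eq_from (esym e01)); ring.
have p01 : a * Phi 0 1 = - a * M 1 0 by apply: (eq_from e00); ring.
have p10 : a * Phi 1 0 = - a * M 0 1 by apply: (eq_from (esym e11)); ring.
have p11 : a * Phi 1 1 = Da + a * M 0 0 by apply: (eq_from e10); ring.
rewrite eD0 eD1; split.
  transitivity (a * Phi 0 0 * k0 + a * Phi 0 1 * k1 + a * k0 * dot pi v
    - 3 * dot pi v' * a * a * v' 0 1); first by ring.
  by rewrite p00 p01; ring.
transitivity (a * Phi 1 0 * k0 + a * Phi 1 1 * k1 + a * k1 * dot pi v
    + 3 * dot pi v' * a * a * v' 0 0); first by ring.
by rewrite p10 p11; ring.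
Qed.

End InvariantForm.

(** * The stabilizer of a velocity *)

Section StabilizerAlgebra.
Context {R : realType}.

(** The invariance identity at the acceleration (x, y), for the generator that fixes the
    velocity; a0 and a1 stand for the gradient of a with respect to the velocity. *)
Definition stabilizer_system (a a0 a1 b00 b01 b10 b11 c0 c1 v0 v1 x y : R) : Prop :=
  let d := v0 * y - v1 * x in let ux := d * v0 - y in let uy := d * v1 + x in
  let k0 := (x * a0 + y * a1) * y + (b00 * x + b01 * y) + c0 in
  let k1 := (x * - a0 + y * - a1) * x + (b10 * x + b11 * y) + c1 in
  (ux * a0 + uy * a1) * y + (x * a0 + y * a1) * uy + (b00 * ux + b01 * uy)
    = v0 * v1 * k0 - (1 - v1 ^+ 2) * k1 - 3 * d * a * y /\
  - (ux * a0 + uy * a1) * x - (x * a0 + y * a1) * ux + (b10 * ux + b11 * uy)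
    = (1 - v0 ^+ 2) * k0 - v0 * v1 * k1 + 3 * d * a * x.

(** The identity is polynomial in the acceleration. Its parts of degree 0 and 2 are linear
    systems for c and for the gradient of a, both of determinant 1 - |v|^2. Its part of degree 1
    says that the inverse of A times B commutes with the infinitesimal stabilizer, which leaves
    two dimensions for B, one of them made of symmetric matrices. *)
Lemma stabilizer_system_solution (a a0 a1 b00 b01 b10 b11 c0 c1 v0 v1 : R) :
  1 - (v0 ^+ 2 + v1 ^+ 2) != 0 ->
  (forall x y, stabilizer_system a a0 a1 b00 b01 b10 b11 c0 c1 v0 v1 x y) ->
  [/\ c0 = 0 /\ c1 = 0,
      a0 * (1 - (v0 ^+ 2 + v1 ^+ 2)) = 3 * a * v0,
      a1 * (1 - (v0 ^+ 2 + v1 ^+ 2)) = 3 * a * v1 &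
      b01 = b10 -> (1 - v1 ^+ 2) * b01 = v0 * v1 * b00 /\
                   (1 - v1 ^+ 2) * b11 = (1 - v0 ^+ 2) * b00].
Proof.
move=> l0 H; have t0 : (2 : R) != 0 by rewrite pnatr_eq0.
have [e0 e1] := H 0 0.
have [c00 c10] : c0 = 0 /\ c1 = 0.
  split; apply: (mulfI l0).
    apply: (eq_from (congr2 (fun p q => v0 * v1 * p - (1 - v1 ^+ 2) * q) e0 e1)); ring.
  apply: (eq_from (congr2 (fun p q => (1 - v0 ^+ 2) * p - v0 * v1 * q) e0 e1)); ring.
have [H01 _] := H 0 1; have [H01' _] := H 0 (- 1).
have [H10 H10s] := H 1 0; have [H10' H10s'] := H (- 1) 0.
rewrite /= c00 c10 in H01 H01' H10 H10' H10s H10s'.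
(* sums over opposite accelerations give the part of degree 2, differences that of degree 1 *)
have d1 : - (1 - v0 ^+ 2) * a0 + v0 * v1 * a1 + 3 * a * v0 = 0.
  by apply: (mulfI t0); apply: (eq_from (congr2 +%R H01 H01')); ring.
have d2 : v0 * v1 * a0 - (1 - v1 ^+ 2) * a1 + 3 * a * v1 = 0.
  by apply: (mulfI t0); apply: (eq_from (congr2 +%R H10s H10s')); ring.
split=> // [||sym].
- apply: (eq_from (congr2 (fun p q => - (1 - v1 ^+ 2) * p - v0 * v1 * q) d1 d2)); ring.
- apply: (eq_from (congr2 (fun p q => - v0 * v1 * p - (1 - v0 ^+ 2) * q) d1 d2)); ring.
rewrite -sym in H10 H10' H01 H01'; split; apply: (mulfI t0).
  by apply: (mulfI t0); apply: (eq_from (congr2 (fun p q => p - q) H10 H10')); ring.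
by apply: (eq_from (congr2 (fun p q => p - q) H01 H01')); ring.
Qed.

End StabilizerAlgebra.

Section Stabilizer.
Context {R : realType} (E : jet R 3 -> 'rV[R]_2) (A B : jet R 1 -> 'M[R]_2)
  (c : jet R 1 -> 'rV[R]_2) (form : third_order_form E A B c)
  (LI : lorentz_invariant A (kcoef A B c)).
Implicit Types (v u : 'rV[R]_2).

Local Notation k := (kcoef A B c).

(** The boost that compensates the infinitesimal rotation (om = 1) of the velocity v, see
    [lorentz_vel_stabilizer]. *)
Definition stabilizer v : 'rV[R]_2 := \row_i (if i == 0 then v 0 1 else - v 0 0).

Lemma stabilizerE v : (stabilizer v 0 0 = v 0 1) * (stabilizer v 0 1 = - v 0 0).
Proof. by rewrite !mxE. Qed.

Lemma dot_stabilizer v : dot (stabilizer v) v = 0.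
Proof. rewrite dotE !stabilizerE; ring. Qed.

Lemma lorentz_vel_stabilizer v : lorentz_vel (stabilizer v) 1 v = 0.
Proof.
by apply/rowP; apply: ord2P; rewrite /lorentz_vel dot_stabilizer !mxE /=; ring.
Qed.

(** No derivative with respect to the velocity is left, since the generator does not move it. *)
Lemma stabilizer_equations v v' : 0 < lor v ->
  let a := A (vjet v) 0 1 in let al l := pder (inord 1) l (fun z => A z 0 1) (vjet v) in
  let b i j := B (vjet v) i j in
  let v0 := v 0 0 in let v1 := v 0 1 in let x := v' 0 0 in let y := v' 0 1 in
  let d := v0 * y - v1 * x in let ux := d * v0 - y in let uy := d * v1 + x in
  let k0 := (x * al 0 + y * al 1) * y + (b 0 0 * x + b 0 1 * y) + c (vjet v) 0 0 in
  let k1 := (x * - al 0 + y * - al 1) * x + (b 1 0 * x + b 1 1 * y) + c (vjet v) 0 1 in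
  (ux * al 0 + uy * al 1) * y + (x * al 0 + y * al 1) * uy + (b 0 0 * ux + b 0 1 * uy)
    = v0 * v1 * k0 - (1 - v1 ^+ 2) * k1 - 3 * d * a * y /\
  - (ux * al 0 + uy * al 1) * x - (x * al 0 + y * al 1) * ux + (b 1 0 * ux + b 1 1 * uy)
    = (1 - v0 ^+ 2) * k0 - v0 * v1 * k1 + 3 * d * a * x.
Proof.
move=> v_0 a al b v0 v1 x y d ux uy k0 k1.
have [_ _ _ a0] := skewA form (timelike_vjet v_0).
have [] := lorentz_components form LI (stabilizer v) 1 v' v_0.
have [-> -> -> ->] := kcoef_skew form v' (lorentz_vel (stabilizer v) 1 v)
  (lorentz_acc (stabilizer v) 1 v v') v_0.
rewrite lorentz_vel_stabilizer vjet0 !derive0 dot_stabilizer -/a -/x -/y -/(al 0) -/(al 1).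
rewrite -!/(b _ _) -/k0 -/k1.
have -> : lorentz_acc (stabilizer v) 1 v v' 0 0 = ux.
  by rewrite /lorentz_acc dot_stabilizer !mxE dotE !stabilizerE /ux /d -/v0 -/v1 -/x -/y /=; ring.
have -> : lorentz_acc (stabilizer v) 1 v v' 0 1 = uy.
  by rewrite /lorentz_acc dot_stabilizer !mxE dotE !stabilizerE /uy /d -/v0 -/v1 -/x -/y /=; ring.
rewrite !mxE dot_stabilizer !dotE !stabilizerE -/v0 -/v1 -/x -/y /= => e0 e1.
rewrite -/a in a0; clearbody k0 k1 al b a.
by split; apply: (mulfI a0); [apply: (eq_from e0)|apply: (eq_from e1)]; rewrite /d; ring.
Qed.

Lemma stabilizer_consequences v : 0 < lor v ->
  let a := A (vjet v) 0 1 in let al l := pder (inord 1) l (fun z => A z 0 1) (vjet v) in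
  let b := B (vjet v) in
  [/\ c (vjet v) 0 0 = 0 /\ c (vjet v) 0 1 = 0,
      al 0 * lor v = 3 * a * v 0 0,
      al 1 * lor v = 3 * a * v 0 1 &
      b 0 1 = b 1 0 -> (1 - v 0 1 ^+ 2) * b 0 1 = v 0 0 * v 0 1 * b 0 0 /\
                       (1 - v 0 1 ^+ 2) * b 1 1 = (1 - v 0 0 ^+ 2) * b 0 0].
Proof.
move=> v0 a al b; have l0 : 1 - (v 0 0 ^+ 2 + v 0 1 ^+ 2) != 0.
  by rewrite -lorE lt0r_neq0.
rewrite lorE; apply: (stabilizer_system_solution l0) => x y.
have := stabilizer_equations (row2 x y) v0.
cbv zeta; rewrite !row2E; exact.
Qed.

End Stabilizer.

(** * Constancy along rays in velocity space *)

Section BoostAlgebra.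
Context {R : realType}.

(** The first component of the invariance identity for a pure boost, at the acceleration (x, 0).
    As the second entry is 0, the derivatives d0, d1 of the gradient of a cancel; the part that
    is odd in x then isolates the derivative D of B_11. *)
Definition boost_system
    (a Da a0 a1 b00 b01 b10 b11 c0 c1 d0 d1 D D1 dc dv q M11 M10 u0 u1 x : R) :=
  a * ((x * d0 + 0 * d1 + (u0 * x * a0 + u1 * x * a1)) * 0
     + (x * a0 + 0 * a1) * (u1 * x)
     + (b00 * (u0 * x) + b01 * (u1 * x)) + (D * x + D1 * 0) + dc) =
  (Da + a * M11) * ((x * a0 + 0 * a1) * 0 + (b00 * x + b01 * 0) + c0)
  - a * M10 * ((x * - a0 + 0 * - a1) * x + (b10 * x + b11 * 0) + c1)
  + a * ((x * a0 + 0 * a1) * 0 + (b00 * x + b01 * 0) + c0) * dv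
  - 3 * q * a * a * 0.

Lemma boost_system_odd_part
    (a Da a0 a1 b00 b01 b10 b11 c0 c1 d0 d1 D D1 dc dv q q' M11 M10 u0 u1 : R) :
  boost_system a Da a0 a1 b00 b01 b10 b11 c0 c1 d0 d1 D D1 dc dv q M11 M10 u0 u1 1 ->
  boost_system a Da a0 a1 b00 b01 b10 b11 c0 c1 d0 d1 D D1 dc dv q' M11 M10 u0 u1 (- 1) ->
  a * (b00 * u0 + b01 * u1 + D) = (Da + a * M11) * b00 - a * M10 * b10 + a * b00 * dv.
Proof.
move=> h1 h2; have t0 : (2 : R) != 0 by rewrite pnatr_eq0.
by apply: (mulfI t0); apply: (eq_from (congr2 (fun p q => p - q) h1 h2)); ring.
Qed.

End BoostAlgebra.

Section Rays.
Context {R : realType}.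
Implicit Types (v u : 'rV[R]_2).

Lemma vjetZ h v : vjet (h *: v) = h *: vjet v.
Proof.
by rewrite /vjet ijetZ mulr0; apply: eq_ijet => -[|[|m]] _ //=; rewrite ?nth_nil scaler0.
Qed.

Lemma lorZ (h : R) v : lor (h *: v) = 1 - h * h * (v 0 0 ^+ 2 + v 0 1 ^+ 2).
Proof. rewrite lorE !mxE; ring. Qed.

Lemma lor_ray v (h : R) : 0 < lor v -> 0 <= h <= 1 -> 0 < lor (h *: v).
Proof.
rewrite lorZ lorE => l0 /andP[h0 h1].
have r0 : 0 <= v 0 0 ^+ 2 + v 0 1 ^+ 2 by rewrite addr_ge0 ?sqr_ge0.
have hh : h * h * (v 0 0 ^+ 2 + v 0 1 ^+ 2) <= v 0 0 ^+ 2 + v 0 1 ^+ 2.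
  by rewrite ler_piMl // mulr_ile1.
by apply: lt_le_trans l0 _; rewrite lerD2l lerN2.
Qed.

Lemma is_derive_ray (f : jet R 1 -> R) v (h : R) : differentiable f (vjet (h *: v)) ->
  is_derive h (1 : R) (fun r => f (vjet (r *: v))) ('D_(vjet v) f (vjet (h *: v))).
Proof.
have -> : (fun r => f (vjet (r *: v))) = (fun r => f (r *: vjet v + 0)).
  by apply/funext => r; rewrite vjetZ addr0.
rewrite vjetZ -[X in 'D_ _ _ X]addr0 -[X in differentiable _ X]addr0 => df.
by apply: is_derive_line; exact: diff_derivable.
Qed.

End Rays.

Section AlongRays.
Context {R : realType} (E : jet R 3 -> 'rV[R]_2) (A B : jet R 1 -> 'M[R]_2)
  (c : jet R 1 -> 'rV[R]_2) (form : third_order_form E A B c)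
  (LI : lorentz_invariant A (kcoef A B c)).
Implicit Types (v u : 'rV[R]_2).

Lemma derive_a_ray v (h : R) : 0 < lor (h *: v) ->
  'D_(vjet v) (fun z => A z 0 1) (vjet (h *: v)) * lor (h *: v) =
    3 * A (vjet (h *: v)) 0 1 * h * (v 0 0 ^+ 2 + v 0 1 ^+ 2).
Proof.
move=> l0; have [_ e0 e1 _] := stabilizer_consequences form LI l0.
rewrite derive_vjet; last exact: smooth_differentiable (smoothA form 0 1) (timelike_vjet l0).
have gen (p0 p1 l a x y : R) : p0 * l = 3 * a * (h * x) -> p1 * l = 3 * a * (h * y) ->
    (x * p0 + y * p1) * l = 3 * a * h * (x ^+ 2 + y ^+ 2).
  move=> e e'; transitivity (x * (p0 * l) + y * (p1 * l)); first by ring.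
  by rewrite e e'; ring.
by apply: gen; [apply: (etrans e0)|apply: (etrans e1)]; rewrite !mxE.
Qed.

(** On a ray, a satisfies the linear differential equation of (1 - |v|^2)^(-3/2). *)
Lemma A_ray_constant v : 0 < lor v ->
  A (vjet v) 0 1 * (lor v * Num.sqrt (lor v)) = A (vjet 0) 0 1.
Proof.
move=> v0; pose rho := v 0 0 ^+ 2 + v 0 1 ^+ 2.
pose F (h : R) := A (vjet (h *: v)) 0 1 * ((1 - h * h * rho) * Num.sqrt (1 - h * h * rho)).
have F1 : F 1 = A (vjet v) 0 1 * (lor v * Num.sqrt (lor v)).
  by rewrite /F scale1r !mul1r lorE.
have F0 : F 0 = A (vjet 0) 0 1.
  by rewrite /F scale0r !mul0r subr0 sqrtr1 !mulr1.
rewrite -F1 -F0; apply: eq_derive0_01 => h /(lor_ray v0) l0.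
have da := is_derive_ray (smooth_differentiable (smoothA form 0 1) (timelike_vjet l0)).
have e := derive_a_ray l0; rewrite lorZ -/rho in l0 e.
apply: (is_derive_eq (is_derive_mul da (is_derive_pow32 l0))).
by rewrite mulrC mulrAC mulrC -mulrA [_ * Num.sqrt _ * _]mulrC mulrA mulrA e; ring.
Qed.

(** A boost along v moves the velocity along the ray of v, and [stabilizer_consequences]
    expresses B_12 by B_11: the invariance identity becomes a linear differential equation for
    B_11 on the ray. *)
Lemma derive_b_ray v (h : R) : 0 < lor (h *: v) ->
  B (vjet (h *: v)) 0 1 = B (vjet (h *: v)) 1 0 ->
  let k := 1 - h * h * v 0 1 ^+ 2 in
  'D_(vjet v) (fun z => B z 0 0) (vjet (h *: v)) * (k * lor (h *: v)) =
    h * B (vjet (h *: v)) 0 0 * (k * (3 * v 0 0 ^+ 2 + v 0 1 ^+ 2)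
      + 2 * h * h * v 0 0 ^+ 2 * v 0 1 ^+ 2).
Proof.
move=> l0 sym k0; set w := h *: v in l0 sym *; set l := lor w in l0 *.
have lN0 : l != 0 by rewrite gt_eqF.
(* the boost whose velocity component at w = h v is exactly v *)
pose pi := row2 (v 0 0 / l) (v 0 1 / l).
have lE : l = 1 - h * h * (v 0 0 ^+ 2 + v 0 1 ^+ 2) by exact: lorZ.
have dpw : dot pi w * l = - (h * (v 0 0 ^+ 2 + v 0 1 ^+ 2)).
  by rewrite dotE !row2E !mxE; field.
have piv : lorentz_vel pi 0 w = v.
  have e0 : lorentz_vel pi 0 w 0 0 = v 0 0 / l + dot pi w * (h * v 0 0).
    by rewrite /lorentz_vel !mxE /=; ring.
  have e1 : lorentz_vel pi 0 w 0 1 = v 0 1 / l + dot pi w * (h * v 0 1).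
    by rewrite /lorentz_vel !mxE /=; ring.
  apply/rowP; apply: ord2P; rewrite ?e0 ?e1; apply: (mulIf lN0);
    rewrite mulrDl divfK // mulrAC dpw lE; ring.
have tv := timelike_vjet l0; have [_ _ _ aN0] := skewA form tv.
have Da := derive_a_ray l0; rewrite -/w -/l in Da.
have [_ _ _ /(_ sym) [b01 _]] := stabilizer_consequences form LI l0.
have u0E x : lorentz_acc pi 0 w (row2 x 0) 0 0 =
    (2 * dot pi w - v 0 0 / l * (h * v 0 0)) * x.
  by rewrite /lorentz_acc (dotE pi (row2 x 0)) !mxE /=; ring.
have u1E x : lorentz_acc pi 0 w (row2 x 0) 0 1 = - (v 0 0 / l * (h * v 0 1)) * x.
  by rewrite /lorentz_acc (dotE pi (row2 x 0)) !mxE /=; ring.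
have M11 : lorentz_mx pi 0 w 1 1 = 2 * dot pi w - h * v 0 1 * (v 0 1 / l).
  by rewrite !mxE /=; ring.
have M10 : lorentz_mx pi 0 w 1 0 = - (h * v 0 1 * (v 0 0 / l)).
  by rewrite !mxE /=; ring.
have boost x : boost_system (A (vjet w) 0 1) ('D_(vjet v) (fun z => A z 0 1) (vjet w))
    (pder (inord 1) 0 (fun z => A z 0 1) (vjet w)) (pder (inord 1) 1 (fun z => A z 0 1) (vjet w))
    (B (vjet w) 0 0) (B (vjet w) 0 1) (B (vjet w) 1 0) (B (vjet w) 1 1)
    (c (vjet w) 0 0) (c (vjet w) 0 1)
    ('D_(vjet v) (pder (inord 1) 0 (fun z : jet R 1 => A z 0 1)) (vjet w))
    ('D_(vjet v) (pder (inord 1) 1 (fun z : jet R 1 => A z 0 1)) (vjet w))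
    ('D_(vjet v) (fun z => B z 0 0) (vjet w)) ('D_(vjet v) (fun z => B z 0 1) (vjet w))
    ('D_(vjet v) (fun z => c z 0 0) (vjet w)) (dot pi w) (dot pi (row2 x 0))
    (2 * dot pi w - h * v 0 1 * (v 0 1 / l)) (- (h * v 0 1 * (v 0 0 / l)))
    (2 * dot pi w - v 0 0 / l * (h * v 0 0)) (- (v 0 0 / l * (h * v 0 1))) x.
  have [Ep _] := lorentz_components form LI pi 0 (row2 x 0) l0.
  have [kp0 kp1 kp2 _] := kcoef_skew form (row2 x 0) v (lorentz_acc pi 0 w (row2 x 0)) l0.
  by rewrite piv kp0 kp1 kp2 u0E u1E M11 M10 !row2E in Ep.
have := boost_system_odd_part (boost 1) (boost (- 1)); rewrite -sym.
have kE : k0 = 1 - w 0 1 ^+ 2 by rewrite /k0 mxE; ring.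
rewrite -kE in b01.
have dE : dot pi w = - (h * (v 0 0 ^+ 2 + v 0 1 ^+ 2)) / l by rewrite -dpw mulfK.
have DE : 'D_(vjet v) (fun z => A z 0 1) (vjet w) =
    3 * A (vjet w) 0 1 * h * (v 0 0 ^+ 2 + v 0 1 ^+ 2) / l by rewrite -Da mulfK.
rewrite dE DE.
move: b01; rewrite !mxE; clearbody l k0.
move: ('D_(vjet v) (fun z => B z 0 0) (vjet w)) (A (vjet w) 0 1) aN0
  (B (vjet w) 0 0) (B (vjet w) 0 1).
move: (v 0 0) (v 0 1) => x y D a aN0 b0 b1 b01 H.
have {H} DlE : D * l = h * b0 * (3 * x ^+ 2 + y ^+ 2) + 2 * h * x * y * b1.
  apply: (mulfI aN0); apply: (eq_from (congr1 ( *%R^~ l) H)).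
  by field.
rewrite mulrCA DlE.
transitivity (k0 * (h * b0 * (3 * x ^+ 2 + y ^+ 2)) + 2 * h * x * y * (k0 * b1)).
  by ring.
by rewrite b01; ring.
Qed.

(** On the ray of v, (1 - (v_2)^2) (1 - |v|^2)^(-3/2) satisfies the differential equation of
    [derive_b_ray]. *)
Lemma B_ray_constant v : 0 < lor v ->
  (forall u, 0 < lor u -> B (vjet u) 0 1 = B (vjet u) 1 0) ->
  B (vjet v) 0 0 * (lor v * Num.sqrt (lor v)) = B (vjet 0) 0 0 * (1 - v 0 1 ^+ 2).
Proof.
move=> v0 sym; pose rho := v 0 0 ^+ 2 + v 0 1 ^+ 2.
have kgt (h : R) : 0 < lor (h *: v) -> 0 < 1 - h * h * v 0 1 ^+ 2.
  rewrite lorZ => /lt_le_trans; apply; rewrite lerD2l lerN2 ler_wpM2l ?sqr_ge0 -?expr2 //.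
  by rewrite lerDr sqr_ge0.
pose F (h : R) := B (vjet (h *: v)) 0 0 * ((1 - h * h * rho) * Num.sqrt (1 - h * h * rho))
   * (1 - h * h * v 0 1 ^+ 2)^-1.
have k1 : 1 - v 0 1 ^+ 2 != 0.
  by have := kgt 1; rewrite scale1r !mul1r => /(_ v0)/lt0r_neq0.
have F1 : F 1 * (1 - v 0 1 ^+ 2) = B (vjet v) 0 0 * (lor v * Num.sqrt (lor v)).
  by rewrite /F scale1r !mul1r lorE mulfVK.
have F0 : F 0 = B (vjet 0) 0 0.
  by rewrite /F scale0r !mul0r !subr0 sqrtr1 invr1 !mulr1.
rewrite -F1 -F0; congr (_ * _); apply: eq_derive0_01 => h /(lor_ray v0) l0.
have db := is_derive_ray (smooth_differentiable (smoothB form 0 0) (timelike_vjet l0)).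
have e := derive_b_ray l0 (sym _ l0); have kp := kgt h l0.
rewrite lorZ -/rho in l0 e.
have kN0 := lt0r_neq0 kp.
have dk := @is_derive_inv _ _ (fun r : R => 1 - r * r * v 0 1 ^+ 2) h (1 : R) _ kN0
  (is_derive_quad (v 0 1 ^+ 2) h).
apply: (is_derive_eq (is_derive_mul (is_derive_mul db (is_derive_pow32 l0)) dk)).
move: e kN0 (lt0r_neq0 l0); rewrite /rho; cbv beta zeta.
move: ('D_(vjet v) _ _) (B _ 0 0) (v 0 0) (v 0 1) => D b x y.
move: (Num.sqrt (1 - h * h * (x ^+ 2 + y ^+ 2))) => s e kN0 lN0.
have -> : D = h * b * ((1 - h * h * y ^+ 2) * (3 * x ^+ 2 + y ^+ 2) +
   2 * h * h * x ^+ 2 * y ^+ 2) / ((1 - h * h * y ^+ 2) * (1 - h * h * (x ^+ 2 + y ^+ 2))).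
  by rewrite -e mulfK // mulf_neq0.
field.
by rewrite kN0 lN0.
Qed.

End AlongRays.

(** * Invariant variational equations are the equations E_mu *)

Section EmuFormula.
Context {R : realType}.

Lemma powR32 (x : R) : 0 < x -> x `^ (3 / 2) = x * Num.sqrt x.
Proof.
move=> x0; have -> : 3 / 2 = 1 + 2^-1 :> R by field.
by rewrite powRD ?gt_eqF ?implybT // powRr1 ?powR12_sqrt // ltW.
Qed.

Lemma powR52 (x : R) : 0 < x -> x `^ (5 / 2) = x * (x * Num.sqrt x).
Proof.
move=> x0; have -> : 5 / 2 = 1 + 3 / 2 :> R by field.
by rewrite powRD ?gt_eqF ?implybT // powRr1 ?powR32 // ltW.
Qed.

Lemma EmuE mu (p : jet R 3) : timelike p ->
  let v := jrow 1 p in let v' := jrow 2 p in let v'' := jrow 3 p in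
  let g := lor v in let s := Num.sqrt g in
  let w := v 0 0 * v' 0 0 + v 0 1 * v' 0 1 in
  Emu mu p 0 0 = (v'' 0 1 + 3 * w * v' 0 1 / g + mu * (g * v' 0 0 + w * v 0 0)) / (g * s) /\
  Emu mu p 0 1 = (- v'' 0 0 - 3 * w * v' 0 0 / g + mu * (g * v' 0 1 + w * v 0 1)) / (g * s).
Proof.
move=> g0 v v' v'' g s w; have s0 : s != 0 by rewrite gt_eqF // sqrtr_gt0.
have gN0 : g != 0 by rewrite gt_eqF.
rewrite /Emu -/v -/v' -/v'' -/g powR32 // powR52 // -/s.
have e (f h : 'rV[R]_2) i : (f - h) 0 i = f 0 i - h 0 i by rewrite !mxE.
have e2 (f h : 'rV[R]_2) i : (f + h) 0 i = f 0 i + h 0 i by rewrite mxE.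
have e3 (f : 'rV[R]_2) i : (- f) 0 i = - f 0 i by rewrite mxE.
have e4 (r : R) (f : 'rV[R]_2) i : (r *: f) 0 i = r * f 0 i by rewrite mxE.
rewrite !(e, e2, e3, e4) !starE !lowerE !dotE.
by clearbody g s; split; rewrite /w; field; rewrite s0 gN0.
Qed.

End EmuFormula.

Lemma Emu_matching (R : realType) (C a a0 a1 b00 b01 b11 b0 g s v0 v1 : R) :
  C != 0 -> 0 < g -> s != 0 -> g = 1 - (v0 ^+ 2 + v1 ^+ 2) ->
  a * (g * s) = C -> a0 * g = 3 * a * v0 -> a1 * g = 3 * a * v1 ->
  b00 * (g * s) = b0 * (1 - v1 ^+ 2) ->
  (1 - v1 ^+ 2) * b01 = v0 * v1 * b00 -> (1 - v1 ^+ 2) * b11 = (1 - v0 ^+ 2) * b00 ->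
  forall x y X Y : R,
  a * Y + ((x * a0 + y * a1) * y + (b00 * x + b01 * y)) =
    C * ((Y + 3 * (v0 * x + v1 * y) * y / g
          + b0 / C * (g * x + (v0 * x + v1 * y) * v0)) / (g * s)) /\
  - a * X + ((x * - a0 + y * - a1) * x + (b01 * x + b11 * y)) =
    C * ((- X - 3 * (v0 * x + v1 * y) * x / g
          + b0 / C * (g * y + (v0 * x + v1 * y) * v1)) / (g * s)).
Proof.
move=> C0 g0 s0 gE aE a0E a1E b00E b01E b11E x y X Y.
have gN0 : g != 0 by rewrite gt_eqF.
have kE : 1 - v1 ^+ 2 = g + v0 ^+ 2 by rewrite gE; ring.
have nE : 1 - v0 ^+ 2 = g + v1 ^+ 2 by rewrite gE; ring.
rewrite kE nE in b00E b01E b11E.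
have k0 : g + v0 ^+ 2 != 0 by rewrite gt_eqF // ltr_wpDr // sqr_ge0.
have {a0E} -> : a0 = 3 * a * v0 / g by rewrite -a0E mulfK.
have {a1E} -> : a1 = 3 * a * v1 / g by rewrite -a1E mulfK.
have {b01E} -> : b01 = v0 * v1 * b00 / (g + v0 ^+ 2) by rewrite -b01E mulrAC mulfV // mul1r.
have {b11E} -> : b11 = (g + v1 ^+ 2) * b00 / (g + v0 ^+ 2).
  by rewrite -b11E mulrAC mulfV // mul1r.
have gs0 : g * s != 0 by rewrite mulf_neq0.
have {b00E} -> : b00 = b0 * (g + v0 ^+ 2) / (g * s) by rewrite -b00E mulfK.
have {aE} -> : a = C / (g * s) by rewrite -aE mulfK.
by split; field; rewrite C0 gN0 s0 k0.
Qed.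

Section Necessity.
Context {R : realType} (E : jet R 3 -> 'rV[R]_2) (A B : jet R 1 -> 'M[R]_2)
  (c : jet R 1 -> 'rV[R]_2) (form : third_order_form E A B c)
  (TI : translation_invariant A (kcoef A B c))
  (LI : lorentz_invariant A (kcoef A B c)).
Implicit Types (v u : 'rV[R]_2).

Lemma E_ijet t (q : nat -> 'rV[R]_2) i : 0 < lor (q 1%N) ->
  E (ijet 3 t q) 0 i = \sum_j A (vjet (q 1%N)) i j * q 3%N 0 j
                       + kcoef A B c (vajet (q 1%N) (q 2%N)) 0 i.
Proof.
move=> l0; have [_ _ _ _ Ef] := form; have [TA Tk] := TI.
have t3 : timelike (ijet 3 t q) by rewrite /timelike jrow_ijet.
rewrite Ef // !jtrunc_ijet // jrow_ijet //; congr (_ + _).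
  apply: eq_bigr => j _; congr (_ * _).
  by rewrite (TA (ijet 1 t q) (vjet (q 1%N))) // /timelike !jrow_ijet.
by rewrite (Tk (ijet 2 t q) (vajet (q 1%N) (q 2%N))) // /timelike !jrow_ijet.
Qed.

Lemma vjet_line v u (s : R) : vjet (v + s *: u) = s *: vjet u + vjet v.
Proof.
rewrite /vjet ijetZ ijetD mulr0 addr0; apply: eq_ijet => -[|[|m]] _ //=.
- by rewrite scaler0 addr0.
- by rewrite addrC.
Qed.

Lemma is_derive_vjet_line (f : jet R 1 -> R) v u : differentiable f (vjet v) ->
  is_derive (0 : R) (1 : R) (fun s => f (vjet (v + s *: u))) ('D_(vjet u) f (vjet v)).
Proof.
have -> : (fun s => f (vjet (v + s *: u))) = (fun s => f (s *: vjet u + vjet v)).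
  by apply/funext => s; rewrite vjet_line.
move=> df; have e : vjet v = 0 *: vjet u + vjet v by rewrite scale0r add0r.
rewrite [in 'D__ _ _]e; apply: is_derive_line; rewrite -e.
exact: diff_derivable.
Qed.

(** On a uniform motion v' = v'' = 0, and c = 0 by invariance: only A and B contribute. *)
Lemma linearized_force v t (phi : nat -> 'rV[R]_2) i : 0 < lor v ->
  is_derive (0 : R) (1 : R)
     (fun s => E (ijet 3 t (fun m => ray v t m + s *: phi m)) 0 i)
     (\sum_j A (vjet v) i j * phi 3%N 0 j + \sum_j B (vjet v) i j * phi 2%N 0 j).
Proof.
move=> v0; have tv := timelike_vjet v0.
pose w (s : R) := v + s *: phi 1%N.
pose F (s : R) := \sum_j A (vjet (w s)) i j * (s * phi 3%N 0 j) +
  (\sum_j \sum_l s * phi 2%N 0 l * pder (inord 1) l (fun y => A y i j) (vjet (w s))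
     * (s * phi 2%N 0 j)
   + \sum_j B (vjet (w s)) i j * (s * phi 2%N 0 j)).
have nF : \forall s \near (0 : R), F s = E (ijet 3 t (fun m => ray v t m + s *: phi m)) 0 i.
  have : \forall s \near (0 : R), timelike (vjet (w s)).
    apply: (@near_open_preimage _ _ [set p : jet R 1 | timelike p]).
    - exact: open_timelike.
    - by rewrite /w scale0r addr0.
    have -> : (fun s => vjet (w s)) = (fun s => s *: vjet (phi 1%N) + vjet v).
      by apply/funext => s; rewrite vjet_line.
    exact: line_continuous.
  apply: filterS => s; rewrite /timelike jrow_ijet //= => ws.
  rewrite E_ijet //= kcoef_vajet -/(w s).
  have [[c0 c1] _ _ _] := stabilizer_consequences form LI ws.
  have -> : c (vjet (w s)) 0 i = 0 by move: i {F}; apply: ord2P.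
  rewrite addr0 /F; congr (_ + (_ + _)); apply: eq_bigr => j _.
  - by rewrite !mxE add0r.
  - by apply: eq_bigr => l _; rewrite !mxE !add0r.
  - by rewrite !mxE add0r.
apply: (near_eq_is_derive nF).
have id0 : is_derive (0 : R) (1 : R) (fun s : R => s) (1 : R) by exact: is_derive_id.
have hl (d : R) : is_derive (0 : R) (1 : R) (fun s : R => s * d) (0 * 0 + d * 1).
  have hc : is_derive (0 : R) (1 : R) (fun=> d : R) (0 : R) by exact: is_derive_cst.
  exact: is_derive_mul.
have df (f : jet R 1 -> R) : smooth_on (@timelike R 1) f ->
    is_derive (0 : R) (1 : R) (fun s => f (vjet (w s))) ('D_(vjet (phi 1%N)) f (vjet v)).
  by move=> sf; apply: is_derive_vjet_line; exact: smooth_differentiable sf tv.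
have sG l j : smooth_on (@timelike R 1) (pder (inord 1) l (fun y => A y i j)).
  exact: (smooth_derive _ (smoothA form i j)).
have w0 : w 0 = v by rewrite /w scale0r addr0.
have dd := is_deriveD (is_derive_fsum (fun j =>
    is_derive_mul (df _ (smoothA form i j)) (hl (phi 3%N 0 j))))
  (is_deriveD (is_derive_fsum (fun j => is_derive_fsum (fun l =>
    is_derive_mul (is_derive_mul (hl (phi 2%N 0 l)) (df _ (sG l j))) (hl (phi 2%N 0 j)))))
   (is_derive_fsum (fun j =>
    is_derive_mul (df _ (smoothB form i j)) (hl (phi 2%N 0 j))))).
apply: (is_derive_eq dd); rewrite w0 [X in _ + (X + _)]big1 ?add0r.
  congr (_ + _); apply: eq_bigr => j _; rewrite !mul0r add0r mulr1 addr0 //.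
by move=> j _; rewrite big1 // => l _; rewrite !mul0r addr0.
Qed.

Context (EP : euler_poisson E).

Lemma B_symmetric v : 0 < lor v -> B (vjet v) 0 1 = B (vjet v) 1 0.
Proof.
move=> v0; apply: (helmholtz (A := A (vjet v)) EP v0).
  by have [_ _ -> _] := skewA form (timelike_vjet v0); rewrite opprK.
by move=> t phi i; exact: linearized_force.
Qed.

Lemma poincare_invariant_Emu : exists C mu : R, C != 0 /\
  forall p : jet R 3, timelike p -> E p = C *: Emu mu p.
Proof.
have l00 : 0 < lor (0 : 'rV[R]_2) by rewrite lorE !mxE expr0n /= addr0 subr0 ltr01.
have [_ _ _ C0] := skewA form (timelike_vjet l00).
pose C := A (vjet 0) 0 1; exists C, (B (vjet 0) 0 0 / C); split => // p.
rewrite (ijet_jrow p); move: p.1 (fun m => jrow m p) => t q tp.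
have l0 : 0 < lor (q 1%N) by move: tp; rewrite /timelike jrow_ijet.
have [] := EmuE (B (vjet 0) 0 0 / C) tp; rewrite /= !jrow_ijet //= => e0 e1.
have [_ _ a10 aN0] := skewA form (timelike_vjet l0).
have ea := A_ray_constant form LI l0; have eb := B_ray_constant form LI l0 B_symmetric.
have [[c0 c1] g0 g1 /(_ (B_symmetric l0)) [b01 b11]] := stabilizer_consequences form LI l0.
have [k0 k1 _ _] := kcoef_skew form (q 2%N) 0 0 l0.
have [a00 a11 _ _] := skewA form (timelike_vjet l0).
have s0 : Num.sqrt (lor (q 1%N)) != 0 by rewrite gt_eqF // sqrtr_gt0.
have [E0 E1] := Emu_matching C0 l0 s0 (lorE (q 1%N)) ea g0 g1 eb b01 b11
  (q 2%N 0 0) (q 2%N 0 1) (q 3%N 0 0) (q 3%N 0 1).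
apply/rowP; apply: ord2P; rewrite mxE ?e0 ?e1 E_ijet // sum2.
  by rewrite k0 a00 c0 mul0r add0r addr0; exact: E0.
by rewrite k1 a10 a11 c1 -(B_symmetric l0) mul0r !addr0; exact: E1.
Qed.

End Necessity.

(** * Lorentz invariance of the equations E_mu *)

Section EmuCoefficients.
Context {R : realType}.

(** (1 + v.v)^(-3/2), without real exponents. *)
Definition ilor32 s (p : jet R s) : R := (jlor p * Num.sqrt (jlor p))^-1.

Definition euc (a b : 'rV[R]_2) : R := a 0 0 * b 0 0 + a 0 1 * b 0 1.

Lemma jlor_gt0 s (p : jet R s) : timelike p -> 0 < jlor p.
Proof. by []. Qed.

Lemma sqrt_jlor_neq0 s (p : jet R s) : timelike p -> Num.sqrt (jlor p) != 0.
Proof. by move=> tp; rewrite gt_eqF // sqrtr_gt0. Qed.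

Lemma smooth_jlor_timelike s : smooth_on (@timelike R s) (@jlor R s).
Proof. by apply: smooth_jlor; exact: open_timelike. Qed.

Lemma smooth_sqrt_jlor s : smooth_on (@timelike R s) (fun p => Num.sqrt (jlor p)).
Proof.
move=> k; apply: Ck_sqrt; [exact: open_timelike|by []|].
exact: smooth_jlor_timelike.
Qed.

Lemma smooth_ilor32 s : smooth_on (@timelike R s) (@ilor32 s).
Proof.
move=> k; apply: CkV; first exact: open_timelike.
  by move=> p tp; rewrite mulf_neq0 ?sqrt_jlor_neq0 // gt_eqF.
apply: CkM; first exact: open_timelike.
  exact: smooth_jlor_timelike.
exact: smooth_sqrt_jlor.
Qed.

Lemma is_derive_jlor s (p w : jet R s) :
  is_derive p w (@jlor R s) (- (2 * euc (jrow 1 p) (jrow 1 w))).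
Proof.
have -> : @jlor R s = (fun p => 1 - (jrow 1 p 0 0 * jrow 1 p 0 0 + jrow 1 p 0 1 * jrow 1 p 0 1)).
  by apply/funext => y; rewrite /jlor lorE !expr2.
have hc : is_derive p w (fun=> 1 : R) (0 : R) by exact: is_derive_cst.
have hj i := is_derive_jrow 1 i p w.
apply: (is_derive_eq (is_deriveB hc (is_deriveD (is_derive_mul (hj 0) (hj 0))
  (is_derive_mul (hj 1) (hj 1))))).
by rewrite /euc; ring.
Qed.

Lemma is_derive_sqrt_jlor s (p w : jet R s) : timelike p ->
  is_derive p w (fun p => Num.sqrt (jlor p))
    (- (euc (jrow 1 p) (jrow 1 w) / Num.sqrt (jlor p))).
Proof.
move=> tp; have dj : differentiable (@jlor R s) p.
  exact: smooth_differentiable (@smooth_jlor_timelike s) tp.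
have d := @is_derive_sqrt R _ (@jlor R s) p w (jlor_gt0 tp) dj.
rewrite (@derive_val _ _ _ _ _ _ _ (is_derive_jlor p w)) in d.
apply: (is_derive_eq d); field; exact: sqrt_jlor_neq0.
Qed.

Lemma is_derive_ilor32 s (p w : jet R s) : timelike p ->
  is_derive p w (@ilor32 s) (3 * euc (jrow 1 p) (jrow 1 w) * ilor32 p / jlor p).
Proof.
move=> tp; have s0 := sqrt_jlor_neq0 tp; have g0 : jlor p != 0 by rewrite gt_eqF.
have gs0 : jlor p * Num.sqrt (jlor p) != 0 by rewrite mulf_neq0.
apply: (is_derive_eq (@is_derive_inv _ _ (fun p => jlor p * Num.sqrt (jlor p)) p w _ gs0
  (is_derive_mul (is_derive_jlor p w) (is_derive_sqrt_jlor w tp)))).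
rewrite /ilor32; have gE : jlor p = Num.sqrt (jlor p) ^+ 2 by rewrite sqr_sqrtr // ltW.
move: s0 gE; move: (Num.sqrt (jlor p)) => x.
move: (jlor p) (euc _ _) => y e x0 ->.
by field.
Qed.

Lemma ilor32_jtrunc s' s (p : jet R s) : (1 <= s')%N -> (s' <= s)%N ->
  ilor32 (jtrunc s' p) = ilor32 p.
Proof. by move=> h1 h2; rewrite /ilor32 /jlor jrow_jtrunc. Qed.

Context (C mu : R).

(** This is - star a, with explicit entries. *)
Definition epsv (a : 'rV[R]_2) : 'rV[R]_2 := row2 (a 0 1) (- a 0 0).

Definition EmuA (z : jet R 1) : 'M[R]_2 :=
  \matrix_(i, j) (C * ilor32 z * ((j == 1)%:R * (i == 0)%:R - (i == 1)%:R * (j == 0)%:R)).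
Definition EmuB (z : jet R 1) : 'M[R]_2 :=
  \matrix_(i, j) (C * mu * ilor32 z *
     (jlor z * (i == j)%:R + jrow 1 z 0 i * jrow 1 z 0 j)).

Lemma smooth_EmuA i j : smooth_on (@timelike R 1) (fun z => EmuA z i j).
Proof.
have -> : (fun z => EmuA z i j) = (fun z => C * ilor32 z *
   ((j == 1)%:R * (i == 0)%:R - (i == 1)%:R * (j == 0)%:R)).
  by apply/funext => z; rewrite mxE.
have o := @open_timelike R 1.
by move=> k; repeat apply: CkM => //; try exact: Ck_cst; exact: smooth_ilor32.
Qed.

Lemma smooth_EmuB i j : smooth_on (@timelike R 1) (fun z => EmuB z i j).
Proof.
have -> : (fun z => EmuB z i j) = (fun z => C * mu * ilor32 z *
     (jlor z * (i == j)%:R + jrow 1 z 0 i * jrow 1 z 0 j)).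
  by apply/funext => z; rewrite mxE.
have o := @open_timelike R 1.
move=> k; apply: CkM => //.
  by apply: CkM => //; [exact: Ck_cst|exact: smooth_ilor32].
apply: CkD => //; apply: CkM => //; try exact: smooth_jrow; last exact: Ck_cst.
exact: smooth_jlor_timelike.
Qed.

(** The closed form of [kcoef EmuA EmuB], see [kcoef_Emu]. *)
Definition Emu_k (i : 'I_2) (p : jet R 2) : R :=
  C * ilor32 p * (3 * euc (jrow 1 p) (jrow 2 p) * (jlor p)^-1 * epsv (jrow 2 p) 0 i
    + mu * (jlor p * jrow 2 p 0 i + euc (jrow 1 p) (jrow 2 p) * jrow 1 p 0 i)).

Lemma EmuAE z i j : EmuA z i j =
  C * ilor32 z * ((j == 1)%:R * (i == 0)%:R - (i == 1)%:R * (j == 0)%:R).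
Proof. by rewrite mxE. Qed.

Lemma EmuBE z i j : EmuB z i j =
  C * mu * ilor32 z * (jlor z * (i == j)%:R + jrow 1 z 0 i * jrow 1 z 0 j).
Proof. by rewrite mxE. Qed.

Lemma derive_EmuA z w i j : timelike z ->
  'D_w (fun z => EmuA z i j) z = EmuA z i j * (3 * euc (jrow 1 z) (jrow 1 w) / jlor z).
Proof.
move=> tz.
have -> : (fun z => EmuA z i j) = (fun z => ilor32 z *
   (C * ((j == 1)%:R * (i == 0)%:R - (i == 1)%:R * (j == 0)%:R))).
  by apply/funext => y; rewrite EmuAE; ring.
set cc := C * _.
have hc : is_derive z w (fun=> cc : R) (0 : R) by exact: is_derive_cst.
apply: (etrans (@derive_val _ _ _ _ _ _ _ (is_derive_mul (is_derive_ilor32 w tz) hc))).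
by rewrite EmuAE /cc; ring.
Qed.

Lemma pder_EmuA z l i j : timelike z ->
  pder (inord 1) l (fun z => EmuA z i j) z = EmuA z i j * (3 * jrow 1 z 0 l / jlor z).
Proof.
move=> tz; apply: (etrans (derive_EmuA _ i j tz)).
rewrite /euc !jrow_delta // inordK //=; congr (_ * (3 * _ / _)).
by move: l; apply: ord2P; rewrite /=; ring.
Qed.

Lemma kcoef_Emu p i : timelike p -> kcoef EmuA EmuB (fun=> 0) p 0 i = Emu_k i p.
Proof.
move=> tp; have tz : timelike (jtrunc 1 p) by rewrite /timelike jrow_jtrunc.
rewrite /kcoef mxE !sum2 !pder_EmuA // [(0 : 'rV_2) 0 i]mxE !EmuAE !EmuBE.
rewrite !ilor32_jtrunc // /jlor !jrow_jtrunc // /Emu_k /euc /jlor.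
by move: i; apply: ord2P; rewrite /epsv !row2E /=; ring.
Qed.

End EmuCoefficients.

Section EmuInvariance.
Context {R : realType} (C mu : R).

Local Notation A := (EmuA C).
Local Notation B := (EmuB C mu).
Local Notation k := (kcoef A B (fun=> 0)).

Lemma Emu_form (E : jet R 3 -> 'rV[R]_2) : C != 0 ->
  (forall p, timelike p -> E p = C *: Emu mu p) -> third_order_form E A B (fun=> 0).
Proof.
move=> C0 EC; split.
- exact: smooth_EmuA.
- exact: smooth_EmuB.
- move=> i n; rewrite (_ : (fun z => _) = (fun=> 0)); first exact: Ck_cst.
  by apply/funext => z; rewrite mxE.
- move=> z tz; split.
    by apply/matrixP; apply: ord2P; apply: ord2P; rewrite !mxE /=; ring.
  apply/eqP => /matrixP /(_ 0 1); rewrite EmuAE mxE /= => /eqP.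
  rewrite mul0r subr0 !mulr1 mulf_eq0 (negbTE C0) invr_eq0 mulf_eq0.
  by rewrite (negbTE (sqrt_jlor_neq0 tz)) orbF gt_eqF.
move=> p tp i; have t2 : timelike (jtrunc 2 p) by rewrite /timelike jrow_jtrunc.
rewrite EC // mxE kcoef_Emu // sum2 !EmuAE ilor32_jtrunc //.
rewrite /Emu_k ilor32_jtrunc // /jlor !jrow_jtrunc //.
have [e0 e1] := EmuE mu tp.
by move: i; apply: ord2P; rewrite ?e0 ?e1 /epsv /ilor32 /euc /jlor !row2E /=; ring.
Qed.

Lemma Emu_translation_invariant : translation_invariant A k.
Proof.
split=> [z z' _ _ e|p p' tp tp' e1 e2].
  by apply/matrixP => i j; rewrite !EmuAE /ilor32 /jlor e.
by apply/rowP => i; rewrite !kcoef_Emu // /Emu_k /ilor32 /jlor e1 e2.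
Qed.

Lemma near_Emu_k p i : timelike p -> \forall y \near p, k y 0 i = Emu_k C mu i y.
Proof. by move=> tp; apply: near_timelike => // y; exact: kcoef_Emu. Qed.

Lemma derive_EmuA_jtrunc (p X : jet R 2) i j : timelike p ->
  'D_(jtrunc 1 X) (fun z => A z i j) (jtrunc 1 p) =
   A (jtrunc 1 p) i j * (3 * euc (jrow 1 p) (jrow 1 X) / jlor p).
Proof.
move=> tp; have tz : timelike (jtrunc 1 p) by rewrite /timelike jrow_jtrunc.
by rewrite derive_EmuA // /jlor !jrow_jtrunc.
Qed.

Lemma derive_Emu_k (p X : jet R 2) i : timelike p ->
  let v := jrow 1 p in let v' := jrow 2 p in let u := jrow 1 X in let u' := jrow 2 X in
  'D_X (fun y => k y 0 i) p =
    3 * euc v u / jlor p * Emu_k C mu i p +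
    C * ilor32 p * (3 * (euc u v' + euc v u') / jlor p * epsv v' 0 i
      + 6 * euc v v' * euc v u / jlor p ^+ 2 * epsv v' 0 i
      + 3 * euc v v' / jlor p * epsv u' 0 i
      + mu * (- (2 * euc v u) * v' 0 i + jlor p * u' 0 i
              + (euc u v' + euc v u') * v 0 i + euc v v' * u 0 i)).
Proof.
move=> tp v v' u u'; rewrite (near_eq_derive _ (near_Emu_k i tp)).
have hj m j := is_derive_jrow m j p X.
have hc (c : R) : is_derive p X (fun=> c : R) (0 : R) by exact: is_derive_cst.
have g0 : jlor p != 0 by rewrite gt_eqF // jlor_gt0.
have de : is_derive p X (fun p => euc (jrow 1 p) (jrow 2 p)) (euc u v' + euc v u').
  apply: (is_derive_eq (is_deriveD (is_derive_mul (hj 1%N 0) (hj 2%N 0))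
    (is_derive_mul (hj 1%N 1) (hj 2%N 1)))).
  by rewrite -/v -/v' -/u -/u' /euc; ring.
have dE : is_derive p X (fun p => epsv (jrow 2 p) 0 i) (epsv u' 0 i).
  move: i; apply: ord2P.
    rewrite (_ : (fun p => _) = (fun p => jrow 2 p 0 1)) ?row2E //.
    by apply/funext => y; rewrite row2E.
  rewrite (_ : (fun p => _) = - (fun p => jrow 2 p 0 0)) ?row2E; last first.
    by apply/funext => y; rewrite row2E.
  exact: (is_deriveN (hj 2%N 0)).
have di := @is_derive_inv _ _ (@jlor R 2) p X _ g0 (is_derive_jlor p X).
have dd := is_derive_mul (is_derive_mul (hc C) (is_derive_ilor32 X tp))
  (is_derive_add (is_derive_mul (is_derive_mul (is_derive_mul (hc 3) de) di) dE)
   (is_derive_mul (hc mu) (is_derive_add (is_derive_mul (is_derive_jlor p X) (hj 2%N i))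
     (is_derive_mul de (hj 1%N i))))).
apply: (etrans (@derive_val _ _ _ _ _ _ _ dd)); cbv beta.
rewrite -/v -/v' -/u -/u' /Emu_k -/v -/v'.
move: g0; move: (ilor32 p) (jlor p) (euc v u) (euc u v' + euc v u') (euc v v').
move=> sg g e1 e2 e3 g0.
by field.
Qed.

(** The factor (1 - |v|^2)^(-3/2) is multiplied by -3 pi.v under the generator, which makes both
    sides polynomial in pi, om, v' and w up to powers of 1 - |v|^2. *)
Lemma Emu_lorentz_invariant : lorentz_invariant A k.
Proof.
move=> pi om.
pose kv (v v' : 'rV[R]_2) := \row_i Emu_k C mu i (vajet v v').
(* Phi is (X A + A M) A^-1 for the generator X and M = [lorentz_mx pi om v]; Xi and Pi are
   the coefficients of dx and dv on the left-hand side. *)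
exists (fun v v' => \matrix_(i, j) (- 3 * dot pi v * (i == j)%:R +
    (if i == 0 then (if j == 0 then lorentz_mx pi om v 1 1 else - lorentz_mx pi om v 1 0)
     else if j == 0 then - lorentz_mx pi om v 0 1 else lorentz_mx pi om v 0 0))).
exists (fun v v' => \matrix_(i, j) (kv v v' 0 i * pi 0 j)).
exists (fun v v' => \matrix_(i, j) (dot pi v' * A (vjet v) i j
    - 2 * (\sum_l A (vjet v) i l * v' 0 l) * pi 0 j)).
move=> p tp i w v v'; have g0 : jlor p != 0 by rewrite gt_eqF // jlor_gt0.
have tz : timelike (jtrunc 1 p) by rewrite /timelike jrow_jtrunc.
have X1 : jrow 1 (lorentz pi om p) = lorentz_vel pi om v.
  exact: (@jrow_ijet R 2 _ (nth 0 [:: _; _; _]) 1 isT).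
have X2 : jrow 2 (lorentz pi om p) = lorentz_acc pi om v v'.
  exact: (@jrow_ijet R 2 _ (nth 0 [:: _; _; _]) 2 isT).
rewrite lie_eform; first last.
- apply: (differentiable_kcoef (smooth_EmuA C) (smooth_EmuB C mu)) => // j n.
  rewrite (_ : (fun z => _) = (fun=> 0)); first exact: Ck_cst.
  by apply/funext => z; rewrite mxE.
- by move=> j; exact: smooth_differentiable (smooth_EmuA C i j) tz.
rewrite derive_Emu_k // X1 X2 -/v -/v'.
rewrite /eform /contact /dlorentz !jrow_ijet //=.
rewrite !sum2 !derive_EmuA_jtrunc // X1 -/v !kcoef_Emu // /Emu_k -/v -/v'.
have gE : jlor p = 1 - (v 0 0 ^+ 2 + v 0 1 ^+ 2) by rewrite /jlor lorE.
have AE i' j : A (vjet v) i' j = A (jtrunc 1 p) i' j.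
  by rewrite !EmuAE ilor32_jtrunc // /ilor32 /jlor jrow_ijet.
have kE i' : kv v v' 0 i' = C * ilor32 p *
   (3 * euc v v' / jlor p * epsv v' 0 i' + mu * (jlor p * v' 0 i' + euc v v' * v 0 i')).
  by rewrite mxE /Emu_k /ilor32 /jlor !jrow_ijet.
have AzE i' j : A (jtrunc 1 p) i' j = C * ilor32 p *
    ((j == 1)%:R * (i' == 0)%:R - (i' == 1)%:R * (j == 0)%:R).
  by rewrite EmuAE ilor32_jtrunc.
have mE (f : 'I_2 -> 'I_2 -> R) a b : (\matrix_(i, j) f i j) a b = f a b by rewrite mxE.
have sJ : ilor32 (jtrunc 1 p) = ilor32 p by rewrite ilor32_jtrunc.
have sP : ilor32 (vjet v) = ilor32 p by rewrite /ilor32 /jlor jrow_ijet.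
rewrite !mE !sum2 ?AE !kE ?AzE ?sJ ?sP; clear kE AE AzE sJ sP X1 X2.
move: g0 gE; move: (jlor p) (ilor32 p) (jrow 0 w) (jrow 1 w) (jrow 2 w) w.1.
move=> g sg w0 w1 w2 wt g0 gE; clear tp tz; clearbody v v'.
have epsE (a : 'rV[R]_2) : (epsv a 0 0 = a 0 1) * (epsv a 0 1 = - a 0 0).
  by rewrite /epsv !row2E.
have lE a b : lorentz_mx pi om v a b = 2 * dot pi v * (a == b)%:R - v 0 a * pi 0 b
     + om * ((b < a)%N%:R - (a < b)%N%:R) by rewrite mxE.
have l0E : (lorentz_vel pi om v 0 0 = pi 0 0 + dot pi v * v 0 0 - om * v 0 1) *
           (lorentz_vel pi om v 0 1 = pi 0 1 + dot pi v * v 0 1 + om * v 0 0).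
  by rewrite /lorentz_vel !mxE /=; split; ring.
have l1E : (lorentz_acc pi om v v' 0 0 =
     2 * dot pi v * v' 0 0 + dot pi v' * v 0 0 - om * v' 0 1) *
   (lorentz_acc pi om v v' 0 1 = 2 * dot pi v * v' 0 1 + dot pi v' * v 0 1 + om * v' 0 0).
  by rewrite /lorentz_acc !mxE /=; split; ring.
have sE (a b c d : R) (x y z t r : 'rV[R]_2) j :
    (a *: x + b *: y + c *: z + d *: t + om *: r) 0 j =
    a * x 0 j + b * y 0 j + c * z 0 j + d * t 0 j + om * r 0 j by rewrite !mxE.
rewrite !sE !rotE /euc !l0E !l1E ?lE !dotE.
move: i; apply: ord2P; rewrite !epsE ?l0E ?l1E !dotE /=.
  by clear - g0 gE; subst g; field.
by clear - g0 gE; subst g; field.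
Qed.

End EmuInvariance.

(** * A Lagrangian for the equations E_mu *)

Section Lagrangian.
Context {R : realType}.

Definition o0 : 'I_3 := Ordinal (isT : (0 < 3)%N).
Definition o1 : 'I_3 := Ordinal (isT : (1 < 3)%N).
Definition o2 : 'I_3 := Ordinal (isT : (2 < 3)%N).

Lemma sum3 (F : 'I_3 -> R) : \sum_m F m = F o0 + F o1 + F o2.
Proof.
rewrite !big_ord_recl big_ord0 addr0 addrA.
by congr (F _ + F _ + F _); apply/val_inj.
Qed.

Lemma euler_lagrange2 (L : jet R 2 -> R) i t q : euler_lagrange L i t q =
  pder o0 i L (ijet 2 t q) - 'D_(ijet 2 1 (fun m => q m.+1)) (pder o1 i L) (ijet 2 t q)
  + 'D_(ijet 3 1 (fun m => q m.+1)) (tder (pder o2 i L)) (ijet 3 t q).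
Proof.
rewrite /euler_lagrange sum3 /= expr0 expr1 sqrrN expr1n !mul1r mulN1r.
apply: (congr2 +%R (congr2 +%R erefl (congr1 -%R (tder_ijet (pder o1 i L) t q)))).
exact: (tder_ijet (tder (pder o2 i L)) t q).
Qed.

(** A primitive H of (1 - |v|^2)^(-3/2) in the first velocity component: the Lagrangian
    - H v'_2 has A_12 = dH/dv_1. *)
Definition Emu_potential (p : jet R 2) : R :=
  jrow 1 p 0 0 * ((1 - jrow 1 p 0 1 * jrow 1 p 0 1) * Num.sqrt (jlor p))^-1.

Lemma kappa_gt0 (p : jet R 2) : timelike p -> 0 < 1 - jrow 1 p 0 1 * jrow 1 p 0 1.
Proof.
rewrite /timelike lorE => /lt_le_trans; apply.
by rewrite -expr2 lerD2l lerN2 lerDr sqr_ge0.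
Qed.

Lemma kappas_neq0 (p : jet R 2) : timelike p ->
  (1 - jrow 1 p 0 1 * jrow 1 p 0 1) * Num.sqrt (jlor p) != 0.
Proof. by move=> tp; rewrite mulf_neq0 ?sqrt_jlor_neq0 // gt_eqF // kappa_gt0. Qed.

Lemma smooth_Emu_potential : smooth_on (@timelike R 2) Emu_potential.
Proof.
have o := @open_timelike R 2; move=> k; apply: CkM => //; first exact: smooth_jrow.
apply: CkV => //; first exact: kappas_neq0.
apply: CkM => //; last exact: smooth_sqrt_jlor.
have -> : (fun p : jet R 2 => 1 - jrow 1 p 0 1 * jrow 1 p 0 1) =
   (fun p => 1 + -1 * (jrow 1 p 0 1 * jrow 1 p 0 1)).
  by apply/funext => p; rewrite mulN1r.
apply: CkD => //; first exact: Ck_cst.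
by apply: CkM => //; [exact: Ck_cst|apply: CkM => //; exact: smooth_jrow].
Qed.

Lemma is_derive_Emu_potential (p w : jet R 2) : timelike p ->
  let v := jrow 1 p in let u := jrow 1 w in
  let kap := 1 - v 0 1 * v 0 1 in let s := Num.sqrt (jlor p) in
  is_derive p w Emu_potential ((u 0 0 + v 0 0 * euc v u / jlor p
      + 2 * v 0 0 * v 0 1 * u 0 1 / kap) / (kap * s)).
Proof.
move=> tp v u kap s; have ks := kappas_neq0 tp; have s0 := sqrt_jlor_neq0 tp.
have k0 : kap != 0 by rewrite gt_eqF // kappa_gt0.
have hc : is_derive p w (fun=> 1 : R) (0 : R) by exact: is_derive_cst.
have hj i := is_derive_jrow 1 i p w.
have dk : is_derive p w (fun y : jet R 2 => 1 - jrow 1 y 0 1 * jrow 1 y 0 1)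
    (- (2 * v 0 1 * u 0 1)).
  by apply: (is_derive_eq (is_deriveB hc (is_derive_mul (hj 1) (hj 1)))); rewrite -/v -/u; ring.
apply: (is_derive_eq (is_derive_mul (hj 0) (@is_derive_inv _ _
  (fun p : jet R 2 => (1 - jrow 1 p 0 1 * jrow 1 p 0 1) * Num.sqrt (jlor p)) p w _ ks
  (is_derive_mul dk (is_derive_sqrt_jlor w tp))))).
have gE : jlor p = s ^+ 2 by rewrite sqr_sqrtr // ltW.
cbv beta; rewrite -/v -/u -/kap -/s gE; rewrite -/s in s0.
move: (euc v u) => e; clearbody kap s; field.
by rewrite k0 s0.
Qed.

Lemma kappaE (p : jet R 2) : 1 - jrow 1 p 0 1 * jrow 1 p 0 1 = jlor p + jrow 1 p 0 0 ^+ 2.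
Proof. by rewrite /jlor lorE; ring. Qed.

Context (C mu : R).

(** The mu-term comes from the Lagrangian of a free relativistic particle. *)
Definition Emu_lagrangian (p : jet R 2) : R :=
  C * (mu * Num.sqrt (jlor p) + - 1 * (Emu_potential p * jrow 2 p 0 1)).

Lemma smooth_Emu_lagrangian : smooth_on (@timelike R 2) Emu_lagrangian.
Proof.
have o := @open_timelike R 2; move=> k; apply: CkM => //; first exact: Ck_cst.
apply: CkD => //; apply: CkM => //; try exact: Ck_cst; first exact: smooth_sqrt_jlor.
by apply: CkM => //; [exact: smooth_Emu_potential|exact: smooth_jrow].
Qed.

Lemma derive_Emu_lagrangian (p w : jet R 2) : timelike p ->
  let v := jrow 1 p in let u := jrow 1 w in let s := Num.sqrt (jlor p) in
  'D_w Emu_lagrangian p = - C * (mu * (euc v u / s) + Emu_potential p * jrow 2 w 0 1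
                      + jrow 2 p 0 1 * 'D_w Emu_potential p).
Proof.
move=> tp v u s.
have hc (c : R) : is_derive p w (fun=> c : R) (0 : R) by exact: is_derive_cst.
have dH := is_derive_diff w (smooth_differentiable smooth_Emu_potential tp).
have hj := is_derive_jrow 2 1 p w.
apply: (etrans (@derive_val _ _ _ _ _ _ _ (is_derive_mul (hc C) (is_derive_add
  (is_derive_mul (hc mu) (is_derive_sqrt_jlor w tp))
  (is_derive_mul (hc (- 1)) (is_derive_mul dH hj)))))); cbv beta.
by rewrite -/v -/u -/s; ring.
Qed.

Local Notation P := (pder o1 1 Emu_potential).

(** Only the derivative in the first velocity component is computed; the other one, [P], cancels
    in the Euler-Lagrange expression. *)
Lemma derive_Emu_potential (p w : jet R 2) : timelike p ->
  'D_w Emu_potential p = jrow 1 w 0 0 * ilor32 p + jrow 1 w 0 1 * P p.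
Proof.
move=> tp; rewrite /pder (@derive_val _ _ _ _ _ _ _ (is_derive_Emu_potential w tp)).
rewrite (@derive_val _ _ _ _ _ _ _ (is_derive_Emu_potential (0, delta_mx o1 1) tp)).
have k0 : jlor p + jrow 1 p 0 0 ^+ 2 != 0 by rewrite -kappaE gt_eqF // kappa_gt0.
have gE : jlor p = Num.sqrt (jlor p) ^+ 2 by rewrite sqr_sqrtr // ltW.
rewrite /euc !jrow_delta //= kappaE /ilor32; move: (sqrt_jlor_neq0 tp) k0.
move: gE; move: (Num.sqrt (jlor p)) => s; move: (jlor p) => g -> s0 k0.
by field; rewrite s0 k0.
Qed.

Lemma pder0_Emu_lagrangian i p : timelike p -> pder o0 i Emu_lagrangian p = 0.
Proof.
move=> tp; apply: (etrans (derive_Emu_lagrangian _ tp)).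
by rewrite derive_Emu_potential // /euc !jrow_delta //=; ring.
Qed.

Lemma pder10_Emu_lagrangian p : timelike p ->
  pder o1 0 Emu_lagrangian p =
    - C * (jrow 2 p 0 1 * ilor32 p + mu * (jrow 1 p 0 0 * (Num.sqrt (jlor p))^-1)).
Proof.
move=> tp; apply: (etrans (derive_Emu_lagrangian _ tp)).
by rewrite derive_Emu_potential // /euc !jrow_delta //=; ring.
Qed.

Lemma pder11_Emu_lagrangian p : timelike p ->
  pder o1 1 Emu_lagrangian p =
    - C * (P p * jrow 2 p 0 1 + mu * (jrow 1 p 0 1 * (Num.sqrt (jlor p))^-1)).
Proof.
move=> tp; apply: (etrans (derive_Emu_lagrangian _ tp)).
by rewrite derive_Emu_potential // /euc !jrow_delta //=; ring.
Qed.

Lemma pder20_Emu_lagrangian p : timelike p -> pder o2 0 Emu_lagrangian p = 0.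
Proof.
move=> tp; apply: (etrans (derive_Emu_lagrangian _ tp)).
by rewrite derive_Emu_potential // /euc !jrow_delta //=; ring.
Qed.

Lemma pder21_Emu_lagrangian p : timelike p -> pder o2 1 Emu_lagrangian p = - C * Emu_potential p.
Proof.
move=> tp; apply: (etrans (derive_Emu_lagrangian _ tp)).
by rewrite derive_Emu_potential // /euc !jrow_delta //=; ring.
Qed.

Lemma tder_pder20 (p : jet R 3) : timelike p -> tder (pder o2 0 Emu_lagrangian) p = 0.
Proof.
move=> tp; have t2 : timelike (jtrunc 2 p) by rewrite /timelike jrow_jtrunc.
rewrite /tder (near_eq_derive _ (near_timelike t2 pder20_Emu_lagrangian)).
by rewrite derive_cst.
Qed.

Lemma tder_pder21 (p : jet R 3) : timelike p -> tder (pder o2 1 Emu_lagrangian) p =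
  - C * (jrow 2 (jtrunc 2 p) 0 0 * ilor32 (jtrunc 2 p) + P (jtrunc 2 p) * jrow 2 (jtrunc 2 p) 0 1).
Proof.
rewrite (ijet_jrow p); move: p.1 (fun m => jrow m p) => t q tp.
have t2 : timelike (ijet 2 t q) by move: tp; rewrite /timelike !jrow_ijet.
rewrite tder_ijet (near_eq_derive _ (near_timelike t2 pder21_Emu_lagrangian)).
have hc : is_derive (ijet 2 t q) (ijet 2 1 (fun m => q m.+1)) (fun=> - C : R) (0 : R).
  exact: is_derive_cst.
have dH := is_derive_diff (ijet 2 1 (fun m => q m.+1))
  (smooth_differentiable smooth_Emu_potential t2).
apply: (etrans (@derive_val _ _ _ _ _ _ _ (is_derive_mul hc dH))).
by rewrite derive_Emu_potential // jtrunc_ijet // !jrow_ijet //; ring.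
Qed.

(** v / sqrt (1 - |v|^2) is the relativistic momentum. *)
Lemma is_derive_momentum (p w : jet R 2) i : timelike p ->
  is_derive p w (fun y : jet R 2 => jrow 1 y 0 i * (Num.sqrt (jlor y))^-1)
   ((jrow 1 w 0 i + jrow 1 p 0 i * euc (jrow 1 p) (jrow 1 w) / jlor p) / Num.sqrt (jlor p)).
Proof.
move=> tp; have s0 := sqrt_jlor_neq0 tp.
have gE : jlor p = Num.sqrt (jlor p) ^+ 2 by rewrite sqr_sqrtr // ltW.
apply: (is_derive_eq (is_derive_mul (is_derive_jrow 1 i p w) (@is_derive_inv _ _
  (fun p : jet R 2 => Num.sqrt (jlor p)) p w _ s0 (is_derive_sqrt_jlor w tp)))).
move: gE s0; move: (Num.sqrt (jlor p)) => s; move: (jlor p) (euc _ _) => g e -> s0.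
by field.
Qed.

Lemma euler_lagrange_Emu t q : timelike (ijet 3 t q) ->
  let v := q 1%N in let v' := q 2%N in let v'' := q 3%N in
  let g := lor v in let s := Num.sqrt g in let w := euc v v' in
  euler_lagrange Emu_lagrangian 0 t q =
    C * ((v'' 0 1 + 3 * w * v' 0 1 / g + mu * (g * v' 0 0 + w * v 0 0)) / (g * s)) /\
  euler_lagrange Emu_lagrangian 1 t q =
    C * ((- v'' 0 0 - 3 * w * v' 0 0 / g + mu * (g * v' 0 1 + w * v 0 1)) / (g * s)).
Proof.
move=> tp v v' v'' g s w.
have t2 : timelike (ijet 2 t q) by move: tp; rewrite /timelike !jrow_ijet.
pose e := ijet 2 1 (fun m => q m.+1).
have hc (c : R) : is_derive (ijet 2 t q) e (fun=> c : R) (0 : R) by exact: is_derive_cst.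
have dY i := is_derive_jrow 2 i (ijet 2 t q) e.
have ds := is_derive_ilor32 e t2.
have dvs i := is_derive_momentum e i t2.
have dP : is_derive (ijet 2 t q) e P ('D_e P (ijet 2 t q)).
  apply: is_derive_diff; exact: smooth_differentiable (smooth_derive _ smooth_Emu_potential) t2.
have J1 : jrow 1 (ijet 2 t q) = v by rewrite jrow_ijet.
have J2 : jrow 2 (ijet 2 t q) = v' by rewrite jrow_ijet.
have K1 : jrow 1 e = v' by rewrite jrow_ijet.
have K2 : jrow 2 e = v'' by rewrite jrow_ijet.
have G : jlor (ijet 2 t q) = g by rewrite /jlor J1.
have g0 : g != 0 by rewrite -G gt_eqF // jlor_gt0.
have s0 : s != 0 by rewrite /s -G sqrt_jlor_neq0.
have S : ilor32 (ijet 2 t q) = (g * s)^-1 by rewrite /ilor32 G.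
rewrite !euler_lagrange2 !pder0_Emu_lagrangian // -/e; split.
  rewrite (near_eq_derive _ (near_timelike t2 pder10_Emu_lagrangian)).
  rewrite [X in _ + X](near_eq_derive _ (near_timelike tp tder_pder20)) derive_cst.
  rewrite (@derive_val _ _ _ _ _ _ _ (is_derive_mul (hc (- C)) (is_derive_add
    (is_derive_mul (dY 1) ds) (is_derive_mul (hc mu) (dvs 0))))).
  rewrite J1 J2 K1 K2 G S -/s -/w; clearbody g s w.
  by field; rewrite g0 s0.
rewrite (near_eq_derive _ (near_timelike t2 pder11_Emu_lagrangian)).
rewrite [X in _ + X](near_eq_derive _ (near_timelike tp tder_pder21)).
have j2 : jtrunc 2 (ijet 3 t q) = ijet 2 t q by rewrite jtrunc_ijet.
(* dP is the same in the derivatives of N and of [pder o1 1 Emu_lagrangian], so it cancels *)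
pose N (y : jet R 2) := - C * (jrow 2 y 0 0 * ilor32 y + P y * jrow 2 y 0 1).
have dN : is_derive (ijet 2 t q) e N _ := is_derive_mul (hc (- C)) (is_derive_add
    (is_derive_mul (dY 0) ds) (is_derive_mul dP (dY 1))).
have sN : smooth_on (@timelike R 2) N.
  have o := @open_timelike R 2; move=> n; apply: CkM => //; first exact: Ck_cst.
  apply: CkD => //; apply: CkM => //; try exact: smooth_jrow; first exact: smooth_ilor32.
  exact: smooth_derive smooth_Emu_potential n.
have dJ : 'D_(ijet 3 1 (fun m => q m.+1)) (fun y => N (jtrunc 2 y)) (ijet 3 t q) =
    'D_e N (ijet 2 t q).
  have dN2 : differentiable N (jtrunc 2 (ijet 3 t q)).
    by rewrite j2; exact: smooth_differentiable sN t2.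
  rewrite (@derive_val _ _ _ _ _ _ _ (is_derive_jtrunc (ijet 3 1 (fun m => q m.+1)) dN2)).
  by rewrite j2 jtrunc_ijet.
rewrite (_ : (fun a : jet R 3 => _) = (fun y => N (jtrunc 2 y))) // dJ.
rewrite (@derive_val _ _ _ _ _ _ _ dN).
rewrite (@derive_val _ _ _ _ _ _ _ (is_derive_mul (hc (- C)) (is_derive_add
    (is_derive_mul dP (dY 1)) (is_derive_mul (hc mu) (dvs 1))))).
rewrite J1 J2 K1 K2 G S -/s -/w; move: ('D_e P _) (P _) => p1 p2.
clearbody g s w.
by field; rewrite g0 s0.
Qed.

Lemma euler_poisson_Emu (E : jet R 3 -> 'rV[R]_2) :
  (forall p, timelike p -> E p = C *: Emu mu p) -> euler_poisson E.
Proof.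
move=> EC t0 q0 l0; exists 2%N, (@timelike R 2), Emu_lagrangian; split.
- exact: open_timelike.
- by rewrite /timelike jrow_ijet.
- exact: smooth_Emu_lagrangian.
move=> t q i _ l1; have tp : timelike (ijet 3 t q) by rewrite /timelike jrow_ijet.
have [e0 e1] := EmuE mu tp; have [f0 f1] := euler_lagrange_Emu tp.
move: e0 e1; rewrite /= !jrow_ijet //= => e0 e1.
by move: i; apply: ord2P; rewrite EC // mxE ?e0 ?e1 ?f0 ?f1.
Qed.

End Lagrangian.

(** * The classification *)

Theorem proposition2 (R : realType) (E : jet R 3 -> 'rV[R]_2) :
  poincare_invariant_third_order_EP E <->
  exists C mu : R, C != 0 /\
    forall p : jet R 3, timelike p -> E p = C *: Emu mu p.
Proof.
split=> [[EP [A [B [c [form TI LI]]]]]|[C [mu [C0 EC]]]].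
  exact: poincare_invariant_Emu form TI LI EP.
split; first exact: euler_poisson_Emu EC.
exists (EmuA C), (EmuB C mu), (fun=> 0); split.
- exact: Emu_form.
- exact: Emu_translation_invariant.
- exact: Emu_lorentz_invariant.
Qed.
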